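(* Let $\{\mathbf{x}^{(k)}\}_{k\ge 1}$ be the sequence generated by the Away-step Stochastic Frank-Wolfe algorithm (ASFW, described in the context) for solving $\min_{\mathbf{x}\in\mathcal{P}}F(\mathbf{x})$, $F=\frac1n\sum_{i=1}^n f_i$. Let $N$ be the number of vertices used to represent the iterates ($N=p+1$ if the representation update uses Carathéodory's theorem, otherwise $N=|V|$), and let $F^*=\min_{\mathbf{x}\in\mathcal{P}}F(\mathbf{x})$. Let $$\rho=\min\Big\{\tfrac12,\ \frac{\Omega_{\mathcal{P}}^2\,\sigma_F}{16N^2L_FD^2}\Big\},\qquad \sigma_F=\min\{\sigma_1,\dots,\sigma_n\},\quad L_F=\max\{L_1,\dots,L_n\},$$ and let the batch sizes be $m^{(i)}=\lceil 1/(1-\rho)^{2i+2}\rceil$. Then there exist a deterministic constant $C_2$ and a number $\beta$ with $0<\beta<\rho\le 1/2$ such that for every $k\ge1$ $$\mathbb{E}\{F(\mathbf{x}^{(k+1)})-F^*\}\le C_2(1-\beta)^{(k-1)/2}.$$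
   Context: Problem. $\mathcal{P}=\{\mathbf{x}\in\mathbb{R}^p:\mathbf{C}\mathbf{x}\le\mathbf{d}\}$, with $\mathbf{C}\in\mathbb{R}^{m\times p}$ (rows $\mathbf{C}_i$) and $\mathbf{d}\in\mathbb{R}^m$, is a non-empty compact polyhedron with more than one point; $V$ is its finite set of vertices, $D=\sup\{\|\mathbf{x}-\mathbf{y}\|:\mathbf{x},\mathbf{y}\in\mathcal{P}\}$ its diameter. For $i=1,\dots,n$, $f_i:\mathbb{R}^p\to\mathbb{R}$ is strongly convex with parameter $\sigma_i>0$ and differentiable with $L_i$-Lipschitz gradient. $F=\frac1n\sum_{i=1}^n f_i$. $\xi$ is uniform on $\{1,\dots,n\}$ and $f(i,\mathbf{x})=f_i(\mathbf{x})$. Constant $\Omega_{\mathcal{P}}=\zeta/\phi$, where $\zeta=\min\{d_i-\mathbf{C}_i\mathbf{v}:\mathbf{v}\in V,\ i\in\{1,\dots,m\},\ d_i>\mathbf{C}_i\mathbf{v}\}$ and $\phi=\max_{i\in\{1,\dots,m\}\setminus I(V)}\|\mathbf{C}_i\|$, with $I(V)=\{i:\mathbf{C}_i\mathbf{v}=d_i\text{ for all }\mathbf{v}\in V\}$. ASFW. Start from $\mathbf{x}^{(1)}\in V$, with weights $\mu^{(1)}_{\mathbf{x}^{(1)}}=1$, $\mu^{(1)}_{\mathbf{v}}=0$ for other $\mathbf{v}\in V$, and $U^{(1)}=\{\mathbf{x}^{(1)}\}$. At iteration $k=1,2,\dots$: (1) Draw $\xi_1,\dots,\xi_{m^{(k)}}$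 i.i.d. copies of $\xi$ (independent of the past); set $F^{(k)}(\mathbf{x})=\frac1{m^{(k)}}\sum_{i=1}^{m^{(k)}}f(\xi_i,\mathbf{x})$, $\mathbf{g}^{(k)}=\nabla F^{(k)}(\mathbf{x}^{(k)})$, $L^{(k)}=\frac1{m^{(k)}}\sum_{i=1}^{m^{(k)}}L_{\xi_i}$. (2) Choose a vertex $\mathbf{p}^{(k)}\in\arg\min_{\mathbf{x}\in\mathcal{P}}\langle\mathbf{g}^{(k)},\mathbf{x}\rangle$ and $\mathbf{u}^{(k)}\in\arg\max_{\mathbf{v}\in U^{(k)}}\langle\mathbf{g}^{(k)},\mathbf{v}\rangle$. (3) If $\langle\mathbf{g}^{(k)},\mathbf{p}^{(k)}+\mathbf{u}^{(k)}-2\mathbf{x}^{(k)}\rangle\le0$, set $\mathbf{d}^{(k)}=\mathbf{p}^{(k)}-\mathbf{x}^{(k)}$, $\gamma^{(k)}_{\max}=1$; otherwise set $\mathbf{d}^{(k)}=\mathbf{x}^{(k)}-\mathbf{u}^{(k)}$, $\gamma^{(k)}_{\max}=\mu^{(k)}_{\mathbf{u}^{(k)}}/(1-\mu^{(k)}_{\mathbf{u}^{(k)}})$. (4) Set $\gamma^{(k)}=\min\{-\langle\mathbf{g}^{(k)},\mathbf{d}^{(k)}\rangle/(L^{(k)}\|\mathbf{d}^{(k)}\|^2),\gamma^{(k)}_{\max}\}$ (with $\gamma^{(k)}=0$ if $\mathbf{d}^{(k)}=0$), or determine it by line search, $\gamma^{(k)}\in\arg\min_{0\le\gamma\le\gamma^{(k)}_{\max}}F^{(k)}(\mathbf{x}^{(k)}+\gamma\mathbf{d}^{(k)})$.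 Set $\mathbf{x}^{(k+1)}=\mathbf{x}^{(k)}+\gamma^{(k)}\mathbf{d}^{(k)}$. (5) Representation update. If $\mathbf{d}^{(k)}=\mathbf{x}^{(k)}-\mathbf{u}^{(k)}$ (away step): $\mu^{(k+1)}_{\mathbf{v}}=\mu^{(k)}_{\mathbf{v}}(1+\gamma^{(k)})$ for $\mathbf{v}\ne\mathbf{u}^{(k)}$, $\mu^{(k+1)}_{\mathbf{u}^{(k)}}=\mu^{(k)}_{\mathbf{u}^{(k)}}(1+\gamma^{(k)})-\gamma^{(k)}$. Otherwise: $\mu^{(k+1)}_{\mathbf{v}}=\mu^{(k)}_{\mathbf{v}}(1-\gamma^{(k)})$ for $\mathbf{v}\neq\mathbf{p}^{(k)}$, $\mu^{(k+1)}_{\mathbf{p}^{(k)}}=\mu^{(k)}_{\mathbf{p}^{(k)}}(1-\gamma^{(k)})+\gamma^{(k)}$. Then $U^{(k+1)}=\{\mathbf{v}\in V:\mu^{(k+1)}_{\mathbf{v}}>0\}$. Optionally, Carathéodory's theorem is then applied to replace this representation $\mathbf{x}^{(k+1)}=\sum_{\mathbf{v}\in U^{(k+1)}}\mu^{(k+1)}_{\mathbf{v}}\mathbf{v}$ by one using a subset of at most $p+1$ of these vertices. *)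

(* Defs.v *)
(* Points of R^p are row vectors ['rV[R]_p], like the rows
   of the constraint matrix. *)
From HB Require Import structures.
From mathcomp Require Export all_boot all_order all_algebra.
From mathcomp Require Export finmap.
From mathcomp Require Export all_classical all_reals all_analysis.
Export numFieldNormedType.Exports.
Export Order.TTheory GRing.Theory Num.Theory.

Set Implicit Arguments.
Unset Strict Implicit.
Unset Printing Implicit Defensive.

Global Open Scope classical_set_scope.
Global Open Scope ring_scope.

Section Euclidean.
Context {R : realType} {p : nat}.
Implicit Types (x y u v : 'rV[R]_p) (h : 'rV[R]_p -> R).

Definition dot u v : R := \sum_(j < p) u 0 j * v 0 j.

(* The library norm on matrices is the sup norm, hence a separate name. *)
Definition enorm u : R := Num.sqrt (dot u u).

Definition grad h x : 'rV[R]_p := \row_j 'D_(delta_mx 0 j) h x.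

Definition lipschitz_gradient (L : R) h :=
  (forall x, differentiable h x) /\
  forall x y, enorm (grad h x - grad h y) <= L * enorm (x - y).

Definition strongly_convex (sigma : R) h :=
  forall x y (t : R), 0 <= t <= 1 ->
    h (t *: x + (1 - t) *: y) <=
    t * h x + (1 - t) * h y - sigma / 2 * t * (1 - t) * enorm (x - y) ^+ 2.

End Euclidean.

Section Polyhedron.
Context {R : realType} {m p : nat}.
Variables (C : 'M[R]_(m, p)) (d : 'cV[R]_m).

Definition polyhedron : set 'rV[R]_p :=
  [set x | forall i, dot (row i C) x <= d i 0].

(* Vertices are the extreme points. *)
Definition vertices : set 'rV[R]_p :=
  [set v | polyhedron v /\
    forall x y (t : R), polyhedron x -> polyhedron y -> 0 < t < 1 ->
      v = t *: x + (1 - t) *: y -> x = v /\ y = v].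

Definition diameter : R :=
  sup [set enorm (x - y) | x in polyhedron & y in polyhedron].

Definition always_active : set 'I_m :=
  [set i | forall v, vertices v -> dot (row i C) v = d i 0].

(* The sets under [inf] and [sup] below are finite, so these are a minimum and
   a maximum. *)
Definition zeta : R :=
  inf [set r | exists v i, [/\ vertices v, dot (row i C) v < d i 0 &
                               r = d i 0 - dot (row i C) v]].

Definition phi : R := sup [set enorm (row i C) | i in ~` always_active].

Definition Omega : R := zeta / phi.

(* [true] when the representation update uses Caratheodory's theorem. [V] is
   finite; [fset_set V] enumerates it. *)
Definition nb_vertices (caratheodory : bool) : nat :=
  if caratheodory then p.+1 else #|` fset_set vertices|%N.

End Polyhedron.

Section Rate.
Context {R : realType} {m p n : nat}.
Variables (C : 'M[R]_(m, p)) (d : 'cV[R]_m) (sigma L : 'I_n -> R).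
Variable caratheodory : bool.

(* Minimum and maximum over the finite index set. *)
Definition sigmaF : R := inf (range sigma).
Definition LF : R := sup (range L).

Definition rho : R :=
  Num.min (1 / 2)
    (Omega C d ^+ 2 * sigmaF /
     (16 * (nb_vertices C d caratheodory)%:R ^+ 2 * LF * diameter C d ^+ 2)).

Definition batch_size (k : nat) : nat :=
  `|Num.ceil (1 / (1 - rho) ^+ (2 * k + 2))|%N.

End Rate.

Section Algorithm.
Context {R : realType} {p n : nat}.
Variables (P V : set 'rV[R]_p) (f : 'I_n -> 'rV[R]_p -> R) (L : 'I_n -> R).
Variable caratheodory : bool.
Implicit Types (x : 'rV[R]_p) (mu : 'rV[R]_p -> R).

Definition objective x : R := n%:R^-1 * \sum_(i < n) f i x.

(* Only the first [b] entries of the sample [s] are used. *)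
Definition batch_objective (b : nat) (s : nat -> 'I_n) x : R :=
  b%:R^-1 * \sum_(i < b) f (s i) x.

Definition batch_lipschitz (b : nat) (s : nat -> 'I_n) : R :=
  b%:R^-1 * \sum_(i < b) L (s i).

(* Weights are functions on the whole space; only their values on [V] matter. *)
Definition active_vertices mu : set 'rV[R]_p := [set v | V v /\ 0 < mu v].

Definition update_weights (away : bool) (q u : 'rV[R]_p) (gamma : R) mu v : R :=
  if away then
    (if v == u then mu u * (1 + gamma) - gamma else mu v * (1 + gamma))
  else
    (if v == q then mu q * (1 - gamma) + gamma else mu v * (1 - gamma)).

Definition caratheodory_reduction x (nu mu : 'rV[R]_p -> R) :=
  [/\ forall v, V v -> 0 <= mu v,
      active_vertices mu `<=` active_vertices nu,
      (active_vertices mu #<= `I_p.+1)%card,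
      \sum_(v \in V) mu v = 1 &
      \sum_(v \in V) mu v *: v = x].

(* One iteration from [(x, mu)] to [(x', mu')] with batch size [b] and sample
   [s]; [q] is the Frank-Wolfe vertex and [u] the away vertex. All ties, and
   the step-size rule, may be resolved arbitrarily at each iteration. *)
Definition asfw_step (b : nat) (s : nat -> 'I_n) x mu x' mu' : Prop :=
  let Fk := batch_objective b s in
  let g := grad Fk x in
  exists (q u : 'rV[R]_p) (gamma : R),
    [/\ V q /\ (forall y, P y -> dot g q <= dot g y),
        active_vertices mu u /\
          (forall v, active_vertices mu v -> dot g v <= dot g u) &
        let away := 0 < dot g (q + u - 2 *: x) in
        let dir := if away then x - u else q - x in
        let gamma_max := if away then mu u / (1 - mu u) else 1 in
        let nu := update_weights away q u gamma mu in
        [/\ gamma = (if dir == 0 then 0 else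
                     Num.min (- dot g dir /
                              (batch_lipschitz b s * enorm dir ^+ 2))
                             gamma_max)
            \/
            (0 <= gamma <= gamma_max /\
             forall t, 0 <= t <= gamma_max ->
               Fk (x + gamma *: dir) <= Fk (x + t *: dir)),
            x' = x + gamma *: dir &
            if caratheodory then caratheodory_reduction x' nu mu'
            else forall v, V v -> mu' v = nu v]].

End Algorithm.

(* [Fil k] is the past at the start of iteration [k]; [xi k i] is the draw
   number [i < b k] of iteration [k]. Iterations are numbered from 1. *)
Record asfw_run {R : realType} {p n : nat} (P V : set 'rV[R]_p)
    (f : 'I_n -> 'rV[R]_p -> R) (L : 'I_n -> R) (caratheodory : bool)
    (b : nat -> nat) {disp : measure_display} {T : measurableType disp}
    (Pr : probability T R) (xi : nat -> nat -> T -> 'I_n)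
    (x : nat -> T -> 'rV[R]_p) (mu : nat -> T -> 'rV[R]_p -> R)
    (Fil : nat -> set (set T)) : Prop := AsfwRun {
  filtration_sigma_algebra : forall k, sigma_algebra setT (Fil k) ;
  filtration_measurable : forall k, Fil k `<=` measurable ;
  filtration_increasing : forall k, Fil k `<=` Fil k.+1 ;
  iterates_adapted : forall k (j : 'I_p) (B : set R), (1 <= k)%N ->
    measurable B -> Fil k ((fun w => x k w 0 j) @^-1` B) ;
  weights_adapted : forall k v (B : set R), (1 <= k)%N -> V v ->
    measurable B -> Fil k ((fun w => mu k w v) @^-1` B) ;
  draws_adapted : forall k i (B : set 'I_n), (1 <= k)%N -> (i < b k)%N ->
    Fil k.+1 (xi k i @^-1` B) ;
  draws_uniform : forall k i (j : 'I_n), (1 <= k)%N -> (i < b k)%N ->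
    Pr (xi k i @^-1` [set j]) = (n%:R^-1)%:E ;
  (* the draws of iteration [k] and the past are mutually independent *)
  draws_independent : forall k (A : set T) (B : 'I_(b k) -> set 'I_n),
    (1 <= k)%N -> Fil k A ->
    Pr (A `&` [set w | forall i : 'I_(b k), B i (xi k i w)]) =
    (Pr A * \prod_(i < b k) Pr (xi k i @^-1` B i))%E ;
  asfw_start : exists2 x1, V x1 & forall w, x 1%N w = x1 /\
    forall v, V v -> mu 1%N w v = (v == x1)%:R ;
  asfw_iterate : forall k w, (1 <= k)%N ->
    asfw_step P V f L caratheodory (b k) (fun i => xi k i w)
      (x k w) (mu k w) (x k.+1 w) (mu k.+1 w)
}.

(* Main.v *)
(* Fix a minimizer y of F over P and let h be the batch function at x. The
   barycenter of the active vertices has slack at least zeta / N in every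
   constraint that is not tight at all of them, so it can be moved in the
   direction y - x by a length Omega / N within P. This bounds the pairwise
   Frank-Wolfe gap below by (Omega / N) <grad h, x - y> / |x - y|, and strong
   convexity and smoothness turn the gap into a contraction of h x - h y by
   1 - rho, unless the step is an away step of maximal length, which removes a
   vertex from the representation. Vertices are added one at a time, so at least
   half of the steps contract, which gives the rate sqrt (1 - rho). Replacing h
   by F costs the deviation of the empirical frequencies of the n functions from
   1 / n, whose mean is O((1 - rho)^(k + 1)) by the choice of the batch sizes.
   Deviations weighted by the contractions still to come add up to
   O(k (1 - rho)^(k / 2)), and beta < rho absorbs the factor k. *)
Require Import Defs.
From mathcomp Require Import ring lra zify.

Set Implicit Arguments.
Unset Strict Implicit.
Unset Printing Implicit Defensive.

(** * Euclidean geometry and quadratic bounds *)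

Section DotProduct.
Context {R : realType} {p : nat}.
Implicit Types u v w : 'rV[R]_p.

Lemma dotC u v : dot u v = dot v u.
Proof. by apply: eq_bigr => j _; rewrite mulrC. Qed.

Lemma dotDr u v w : dot u (v + w) = dot u v + dot u w.
Proof.
by rewrite /dot -big_split; apply: eq_bigr => j _; rewrite mxE mulrDr.
Qed.

Lemma dotZr a u v : dot u (a *: v) = a * dot u v.
Proof.
by rewrite /dot mulr_sumr; apply: eq_bigr => j _; rewrite mxE; ring.
Qed.

Lemma dotDl u v w : dot (u + v) w = dot u w + dot v w.
Proof. by rewrite dotC dotDr !(dotC w). Qed.

Lemma dotZl a u v : dot (a *: u) v = a * dot u v.
Proof. by rewrite dotC dotZr (dotC v). Qed.

Lemma dotNr u v : dot u (- v) = - dot u v.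
Proof. by rewrite -scaleN1r dotZr mulN1r. Qed.

Lemma dotNl u v : dot (- u) v = - dot u v.
Proof. by rewrite -scaleN1r dotZl mulN1r. Qed.

Lemma dot0r u : dot u 0 = 0.
Proof. by rewrite -(scale0r 0) dotZr mul0r. Qed.

Lemma dot_sumr (I : Type) (s : seq I) (a : I -> R) (w : I -> 'rV[R]_p) u :
  dot u (\sum_(i <- s) a i *: w i) = \sum_(i <- s) a i * dot u (w i).
Proof.
elim: s => [|i s IHs]; first by rewrite !big_nil dot0r.
by rewrite !big_cons dotDr dotZr IHs.
Qed.

Lemma dot_ge0 u : 0 <= dot u u.
Proof. by apply: sumr_ge0 => j _; rewrite -expr2 sqr_ge0. Qed.

Lemma dot_eq0 u : (dot u u == 0) = (u == 0).
Proof.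
apply/idP/eqP => [|->]; last by rewrite dot0r.
rewrite psumr_eq0 => [/allP u0|j _]; last by rewrite -expr2 sqr_ge0.
apply/rowP => j; rewrite mxE; apply/eqP.
by have := u0 j; rewrite mem_index_enum -expr2 sqrf_eq0; apply.
Qed.

Lemma enorm_ge0 u : 0 <= enorm u.
Proof. exact: sqrtr_ge0. Qed.

Lemma enorm_sq u : enorm u ^+ 2 = dot u u.
Proof. by rewrite sqr_sqrtr // dot_ge0. Qed.

Lemma enorm_eq0 u : (enorm u == 0) = (u == 0).
Proof. by rewrite -sqrf_eq0 enorm_sq dot_eq0. Qed.

Lemma enorm_gt0 u : (0 < enorm u) = (u != 0).
Proof. by rewrite lt_def enorm_ge0 andbT enorm_eq0. Qed.

Lemma cauchy_schwarz u v : dot u v <= enorm u * enorm v.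
Proof.
have [->|v0] := eqVneq v 0.
  by rewrite dot0r mulr_ge0 ?enorm_ge0.
apply: le_trans (ler_norm _) _.
rewrite -ler_sqr ?nnegrE ?normr_ge0 ?mulr_ge0 ?enorm_ge0 //.
rewrite real_normK ?num_real // exprMn !enorm_sq.
have vv0 : 0 < dot v v by rewrite lt_def dot_ge0 dot_eq0 v0.
have := dot_ge0 (dot v v *: u - dot u v *: v).
rewrite !(dotDl, dotDr, dotNl, dotNr, dotZl, dotZr) (dotC v u) => H.
have {}H : 0 <= dot v v * (dot u u * dot v v - dot u v ^+ 2) by nra.
by rewrite pmulr_rge0 // subr_ge0 in H.
Qed.

End DotProduct.

Section Calculus.
Context {R : realType} {p : nat}.
Implicit Types (h : 'rV[R]_p -> R) (x y v : 'rV[R]_p).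

Lemma derive_dot h x v : differentiable h x -> 'D_v h x = dot (grad h x) v.
Proof.
move=> dh; rewrite deriveE // {1}(row_sum_delta v) linear_sum /dot.
by apply: eq_bigr => j _; rewrite linearZ /= mxE deriveE // mulrC.
Qed.

Lemma is_derive_line h x v (c : R) : differentiable h (x + c *: v) ->
  is_derive c (1 : R) (fun t => h (x + t *: v)) (dot (grad h (x + c *: v)) v).
Proof.
move=> dh; have dhv : derivable h (x + c *: v) v by exact: diff_derivable.
have E : (fun s : R => s^-1 *: (((fun t => h (x + t *: v)) \o shift c) (s *: 1)
                         - h (x + c *: v))) =
    (fun s : R => s^-1 *: ((h \o shift (x + c *: v)) (s *: v)
                         - h (x + c *: v))).
  apply/funext => s /=; congr (_ *: (h _ - _)).
  rewrite /shift /= scalerDl addrCA; congr (_ + (_ + _)).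
  by rewrite /GRing.scale /= mulr1.
split; first by rewrite /derivable E.
by rewrite -derive_dot // /derive E.
Qed.

(* The gradient enters the algorithm's analysis only through the two quadratic
   bounds below; unlike the Lipschitz condition they pass to averages without
   any triangle inequality. *)
Definition quadratic_upper (L : R) h := forall x y,
  h y <= h x + dot (grad h x) (y - x) + L / 2 * enorm (y - x) ^+ 2.

Definition quadratic_lower (sigma : R) h := forall x y,
  h x + dot (grad h x) (y - x) + sigma / 2 * enorm (y - x) ^+ 2 <= h y.

Lemma lipschitz_gradient_bounds (L : R) h : lipschitz_gradient L h ->
  quadratic_upper L h /\ quadratic_lower (- L) h.
Proof.
move=> hL; have [dh lip] := hL.
have key x v (s : R) (hs : s ^+ 2 = 1) :
    s * (h (x + v) - h x - dot (grad h x) v) <= L / 2 * enorm v ^+ 2.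
  (* The sign [s] covers both bounds at once. Since [q 0] is [s * h x], the claim is [q 1 <= q 0];
     by the mean value theorem it follows from [dq c <= 0], which is Cauchy-Schwarz plus the
     Lipschitz condition. *)
  pose q (t : R) := s * (h (x + t *: v) - t * dot (grad h x) v)
                    - t ^+ 2 * (L / 2 * enorm v ^+ 2).
  pose dq (t : R) := s * dot (grad h (x + t *: v) - grad h x) v
                     - t * (L * enorm v ^+ 2).
  have dqE (c : R) : is_derive c (1 : R) q (dq c).
    have dl := is_derive_line (dh (x + c *: v)).
    apply: is_derive_eq; rewrite /dq dotDl dotNl /GRing.scale /=; field => //.
  have cq : {within `[0, 1]%classic, continuous q}.
    by apply: derivable_within_continuous => c _; have [] := dqE c.
  have [c cI E] := MVT ltr01 (fun c _ => dqE c) cq.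
  move: cI E; rewrite in_itv /= => /andP[c0 _].
  rewrite /q !scale1r scale0r addr0 => E.
  have : dq c <= 0.
    rewrite /dq subr_le0.
    have -> : s * dot (grad h (x + c *: v) - grad h x) v =
       dot (grad h (x + c *: v) - grad h x) (s *: v) by rewrite dotZr.
    apply: le_trans (cauchy_schwarz _ _) _.
    have -> : enorm (s *: v) = enorm v.
      by rewrite /enorm dotZl dotZr mulrA -expr2 hs mul1r.
    have -> : c * (L * enorm v ^+ 2) = (L * (c * enorm v)) * enorm v by ring.
    apply: ler_wpM2r; first exact: enorm_ge0.
    apply: le_trans (lip _ _) _.
    have -> : x + c *: v - x = c *: v by rewrite addrC addKr.
    have -> // : enorm (c *: v) = c * enorm v.
    rewrite /enorm dotZl dotZr mulrA -expr2 sqrtrM ?sqr_ge0 //.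
    by rewrite sqrtr_sqr ger0_norm // ltW.
  move: E; rewrite !mul1r !mul0r expr1n expr0n /= !mul0r !mul1r !subr0 ?mulr1; lra.
split=> x y.
- by have := key x (y - x) 1 (expr1n _ _); rewrite (addrC x) subrK; lra.
- have := key x (y - x) (-1) (etrans (sqrrN 1) (expr1n _ _)).
  by rewrite (addrC x) subrK; lra.
Qed.

(** Any crude lower bound controls [h] near [x] to first order, which replaces differentiating the
    convexity inequality at [t = 0]. It is applied with a negative [L], the one coming from the
    Lipschitz gradient. *)
Lemma strongly_convex_quadratic_lower (sigma L : R) h :
  strongly_convex sigma h -> quadratic_lower L h -> quadratic_lower sigma h.
Proof.
move=> hs hL x y; set g := dot _ _; set r := enorm _ ^+ 2.
have r0 : 0 <= r by exact: sqr_ge0.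
(* Comparing both bounds at [x + t (y - x)] and dividing by [t] leaves an error
   that is linear in [t]. *)
have key (t : R) : 0 < t <= 1 ->
    g <= h y - h x - sigma / 2 * r + t * ((sigma - L) / 2 * r).
  move=> /andP[t0 t1].
  have := hs y x t; rewrite ltW // t1 => /(_ isT).
  have E : t *: y + (1 - t) *: x = x + t *: (y - x).
    by rewrite scalerBl scale1r scalerBr addrCA addrA.
  rewrite E => U; have := hL x (x + t *: (y - x)).
  have -> : x + t *: (y - x) - x = t *: (y - x) by rewrite addrC addKr.
  rewrite enorm_sq dotZr dotZr dotZl -enorm_sq -/g -/r => Lo.
  have : t * g <= t * (h y - h x - sigma / 2 * r + t * ((sigma - L) / 2 * r)).
    by rewrite -/r in U; lra.
  by rewrite ler_pM2l.
have {key} : g <= h y - h x - sigma / 2 * r.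
  apply/ler_addgt0Pr => e e0; set A := (sigma - L) / 2 * r in key.
  have dA : 0 < `|A| + e by rewrite ltr_wpDl.
  (* This [t] is at most 1 and makes the error [t * A] at most [e]; the summand [e] keeps the
     denominator positive when [A] vanishes. *)
  have := key (e / (`|A| + e)).
  rewrite divr_gt0 //= ler_pdivrMr // mul1r lerDr normr_ge0 => /(_ isT) H.
  apply: le_trans H _; rewrite lerD2l.
  apply: le_trans (ler_norm _) _; rewrite normrM (ger0_norm (divr_ge0 (ltW e0) (ltW dA))).
  rewrite mulrAC ler_pdivrMr // ler_pM2l // lerDl. exact: ltW.
by lra.
Qed.

End Calculus.

Section Average.
Context {R : realType} {p b : nat}.
Variable h : 'I_b -> 'rV[R]_p -> R.
Hypothesis b0 : (0 < b)%N.
Hypothesis dh : forall i x, differentiable (h i) x.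

(** Both [objective] and [batch_objective] are instances up to conversion, the latter with [h i] the
    function drawn at place [i]. *)
Definition average (x : 'rV[R]_p) : R := b%:R^-1 * \sum_(i < b) h i x.

Let averageE : average = b%:R^-1 *: (\sum_(i < b) h i).
Proof. by apply/funext => y; rewrite /average /= fct_sumE. Qed.

Lemma differentiable_average x : differentiable average x.
Proof. by rewrite averageE; apply: differentiableZ; exact: differentiable_sum. Qed.

Lemma dot_grad_average x v :
  dot (grad average x) v = b%:R^-1 * \sum_(i < b) dot (grad (h i) x) v.
Proof.
have ds : differentiable (\sum_(i < b) h i) x by exact: differentiable_sum.
rewrite -derive_dot ?averageE; last exact: differentiableZ.
rewrite deriveZ; last exact: diff_derivable.
rewrite derive_sum; last by move=> i; exact: diff_derivable.
by congr (_ * _); apply: eq_bigr => i _; rewrite derive_dot.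
Qed.

Lemma average_quadratic_upper (L : 'I_b -> R) :
  (forall i, quadratic_upper (L i) (h i)) ->
  quadratic_upper (b%:R^-1 * \sum_(i < b) L i) average.
Proof.
move=> hL x y; rewrite dot_grad_average /average.
set r := enorm _ ^+ 2.
have -> : b%:R^-1 * (\sum_(i < b) L i) / 2 * r
          = b%:R^-1 * \sum_(i < b) (L i / 2 * r).
  by rewrite -mulr_suml -mulr_suml; ring.
rewrite -!mulrDr ler_pM2l ?invr_gt0 ?ltr0n // -!big_split /=.
by apply: ler_sum => i _; exact: hL.
Qed.

Lemma average_quadratic_lower (s : R) :
  (forall i, quadratic_lower s (h i)) -> quadratic_lower s average.
Proof.
move=> hs x y; rewrite dot_grad_average /average.
set r := enorm _ ^+ 2.
have -> : s / 2 * r = b%:R^-1 * \sum_(i < b) (s / 2 * r).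
  rewrite sumr_const card_ord -[in RHS](mulr_natl (s / 2 * r)) mulKf //.
  by rewrite pnatr_eq0 -lt0n.
rewrite -!mulrDr ler_pM2l ?invr_gt0 ?ltr0n // -!big_split /=.
by apply: ler_sum => i _; exact: hs.
Qed.

End Average.

(** * Polyhedra and their vertices *)

Section FiniteBounds.
Context {R : realType}.

Lemma seq_positive_lower_bound (s : seq R) :
  exists2 e : R, 0 < e & forall a, a \in s -> 0 < a -> e <= a.
Proof.
elim: s => [|a s [e e0 es]]; first by exists 1.
exists (if 0 < a then Num.min a e else e) => [|b].
  by case: ifP => // a0; rewrite lt_min a0 e0.
rewrite inE => /predU1P[->|bs] b0; first by rewrite b0 ge_min lexx.
by case: ifP => _; rewrite ?ge_min es ?orbT.
Qed.

Lemma finite_set_has_ubound (A : set R) : finite_set A -> has_ubound A.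
Proof.
move=> /finite_seqP[s ->]; elim: s => [|a s [M sM]]; first by exists 0.
exists (Num.max a M) => b /=; rewrite inE => /predU1P[->|/sM bM].
  by rewrite le_max lexx.
by rewrite le_max bM orbT.
Qed.

End FiniteBounds.

Section Polyhedra.
Context {R : realType} {m p : nat}.
Variables (C : 'M[R]_(m, p)) (d : 'cV[R]_m).
Local Notation P := (polyhedron C d).
Local Notation V := (vertices C d).

(** With equal tight constraints, the segment from [w] to [v] can be prolonged beyond [v] within
    [P], so extremality of [v] forces [w = v]. *)
Lemma vertices_active_inj v w : V v -> V w ->
  (forall i, (dot (row i C) v == d i 0) = (dot (row i C) w == d i 0)) -> v = w.
Proof.
move=> Vv [Pw _] vw; have [Pv ext] := Vv.
pose a i := d i 0 - dot (row i C) v.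
pose b i := dot (row i C) v - dot (row i C) w.
have [e e0 he] := seq_positive_lower_bound [seq a i / (`|b i| + 1) | i : 'I_m].
(* Moving from [w] through [v] and a little beyond stays in [P]. *)
have Pz : P (v + e *: (v - w)).
  move=> i; rewrite dotDr dotZr dotDr dotNr -/(b i).
  have := Pv i; rewrite le_eqVlt => /predU1P[va|vlt].
    have /eqP wa : dot (row i C) w == d i 0 by rewrite -vw va.
    by rewrite /b va wa subrr mulr0 addr0.
  have bi : 0 < `|b i| + 1 by rewrite ltr_wpDl.
  have ai : 0 < a i by rewrite subr_gt0.
  have : e <= a i / (`|b i| + 1).
    by apply: he; rewrite ?divr_gt0 //; exact: codom_f.
  rewrite ler_pdivlMr // => H; rewrite -lerBrDl -/(a i); apply: le_trans H.
  by rewrite ler_pM2l //; apply: le_trans (ler_norm _) _; rewrite lerDl.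
(* The weight [(1 + e)^-1] on the prolonged point and the rest on [w] give back [v]. *)
have [||_ ->] // := ext (v + e *: (v - w)) w (1 + e)^-1 Pz Pw.
  rewrite invr_gt0 addr_gt0 //= invf_lt1 ?ltrDl ?addr_gt0 //.
apply/rowP => j; rewrite !mxE; field; lra.
Qed.

(** A vertex is determined by its set of tight constraints; [g] inverts this map, so [V] lies in the
    image of a finite type. *)
Lemma finite_vertices : finite_set V.
Proof.
pose act v := [set i | dot (row i C) v == d i 0]%SET.
pose g S := xget 0 [set v | V v /\ act v = S].
apply: (@sub_finite_set _ _ (g @` setT)); last exact/finite_image/finite_finset.
move=> v Vv; exists (act v) => //; rewrite /g.
case: xgetP => [w _ [Vw vw]|/(_ v)]; last by case.
by apply: vertices_active_inj => // i; move/setP/(_ i): vw; rewrite !inE.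
Qed.

Lemma vertices_polyhedron v : V v -> P v. Proof. by case. Qed.

Lemma polyhedron_sum (s : seq 'rV[R]_p) (a : 'rV[R]_p -> R) :
  (forall v, v \in s -> P v) -> (forall v, v \in s -> 0 <= a v) ->
  \sum_(v <- s) a v = 1 -> P (\sum_(v <- s) a v *: v).
Proof.
move=> sP a0 a1 i; rewrite dot_sumr -[leRHS]mul1r -a1 mulr_suml.
rewrite big_seq [leRHS]big_seq; apply: ler_sum => v vs.
by apply: ler_wpM2l; [exact: a0|exact: sP].
Qed.

Hypothesis cP : compact P.

Lemma le_diameter x y : P x -> P y -> enorm (x - y) <= diameter C d.
Proof.
move=> Px Py; apply: ub_le_sup; last by exists x => //; exists y.
have [M [_ /(_ (M + 1))]] := compact_bounded cP; rewrite ltrDl => /(_ ltr01) MP.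
have cle (u : 'rV[R]_p) j : `|u 0 j| <= `|u|.
  rewrite [leRHS]/Num.norm /= mx_normrE.
  exact: (le_bigmax _ (fun ij => `|u ij.1 ij.2|) (0, j)).
(* Compactness bounds the sup norm by [M + 1], hence every coordinate of a difference by
   [2 * (M + 1)]. *)
exists (Num.sqrt (\sum_(j < p) (2 * (M + 1)) ^+ 2)) => _ [u Pu [v Pv <-]].
apply: ler_wsqrtr; apply: ler_sum => j _; rewrite -expr2 -real_normK ?num_real //.
rewrite lerXn2r ?nnegrE //; last first.
  by rewrite !mxE (le_trans (ler_normB _ _)) // mulrDl mul1r;
     rewrite lerD // (le_trans (cle _ _)) //; exact: MP.
by rewrite mulr_ge0 // (le_trans (normr_ge0 u)) //; exact: MP.
Qed.

Lemma diameter_gt0 x y : P x -> P y -> x <> y -> 0 < diameter C d.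
Proof.
move=> Px Py /eqP xy; apply: lt_le_trans (le_diameter Px Py).
by rewrite enorm_gt0 subr_eq0.
Qed.

Lemma finite_slacks : finite_set
  [set r | exists v i, [/\ V v, dot (row i C) v < d i 0 &
                               r = d i 0 - dot (row i C) v]].
Proof.
apply: (@sub_finite_set _ _
  ((fun vi => d vi.2 0 - dot (row vi.2 C) vi.1) @` (V `*` [set: 'I_m]))).
  by move=> r [v [i [Vv _ ->]]]; exists (v, i).
by apply/finite_image/finite_setX; [exact: finite_vertices|exact: finite_finset].
Qed.

Lemma zeta_le v i : V v -> dot (row i C) v < d i 0 ->
  zeta C d <= d i 0 - dot (row i C) v.
Proof.
move=> Vv vi; apply: ge_inf; last by exists v, i.
by exists 0 => r [w [j [_ wj ->]]]; rewrite subr_ge0 ltW.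
Qed.

Lemma enorm_row_le_phi i : ~ always_active C d i -> enorm (row i C) <= phi C d.
Proof.
move=> ai; apply: ub_le_sup; last by exists i.
exact/finite_set_has_ubound/finite_image/finite_finset.
Qed.

(* If every nonzero constraint were tight at [v], then [P] would contain a ray
   from [v] in any direction pointing into it. *)
Lemma slack_row v y : V v -> P y -> y <> v ->
  exists2 i, dot (row i C) v < d i 0 & row i C != 0.
Proof.
move=> Vv Py yv; have Pv := vertices_polyhedron Vv; apply: contrapT => no.
have w0 : 0 < enorm (y - v) by rewrite enorm_gt0 subr_eq0; exact/eqP.
have tight i : dot (row i C) v = d i 0 \/ row i C = 0.
  have [->|Ci] := eqVneq (row i C) 0; [by right|left].
  by apply/eqP; rewrite eq_le Pv leNgt; apply/negP => vi; apply: no; exists i.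
pose t := (diameter C d + 1) / enorm (y - v).
have D0 : 0 <= diameter C d.
  exact: le_trans (enorm_ge0 _) (le_diameter Py Pv).
have t0 : 0 <= t by rewrite divr_ge0 ?enorm_ge0 ?addr_ge0.
have Pt : P (v + t *: (y - v)).
  move=> i; rewrite dotDr dotZr dotDr dotNr; case: (tight i) => [->|Ci].
    by rewrite gerDl mulr_ge0_le0 // subr_le0.
  by have := Pv i; rewrite Ci !(dotC 0) !dot0r subr0 mulr0 addr0.
have := le_diameter Pt Pv; rewrite addrAC subrr add0r leNgt => /negP; apply.
have -> : enorm (t *: (y - v)) = t * enorm (y - v).
  by rewrite /enorm dotZl dotZr mulrA -expr2 sqrtrM ?sqr_ge0 // sqrtr_sqr ger0_norm.
by rewrite /t divfK ?gt_eqF // ltrDl.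
Qed.

(** The row from [slack_row] is a nonzero one that is not always active, so [phi] is positive. It
    also makes the set of slacks nonempty, so that its infimum is not the default value 0, and
    finiteness keeps that infimum positive. *)
Lemma zeta_phi_gt0 v y : V v -> P y -> y <> v -> 0 < zeta C d /\ 0 < phi C d.
Proof.
move=> Vv Py yv; have [i vi Ci] := slack_row Vv Py yv.
have /finite_seqP[s sE] := finite_slacks.
have [e e0 es] := seq_positive_lower_bound s.
split; last first.
  rewrite -enorm_gt0 in Ci; apply: lt_le_trans Ci (enorm_row_le_phi _).
  by move=> /(_ v Vv) E; rewrite E ltxx in vi.
apply: lt_le_trans e0 _; apply: lb_le_inf => [|r rS].
  by exists (d i 0 - dot (row i C) v), v, i.
have rs : r \in s by move: rS; rewrite sE.
by case: rS => w [j [_ wj E]]; apply: es; rewrite // E subr_gt0.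
Qed.

End Polyhedra.

(** * Representations and the Frank-Wolfe gap *)

Lemma sub_in_count (T : eqType) (a1 a2 : pred T) (s : seq T) :
  {in s, forall x, a1 x -> a2 x} -> (count a1 s <= count a2 s)%N.
Proof.
elim: s => //= x s IHs a12; apply: leq_add.
  by have := a12 x (mem_head x s); case: (a1 x) => // ->.
by apply: IHs => y ys; apply: a12; rewrite inE ys orbT.
Qed.

Section Representation.
Context {R : realType} {p : nat}.
Variable vs : seq 'rV[R]_p.
Hypothesis vs_uniq : uniq vs.
Implicit Types (mu nu : 'rV[R]_p -> R) (u v w x : 'rV[R]_p).

(** This count is the potential of the amortized argument: the number of iterations without
    contraction is charged to it. *)
Definition nb_active mu : nat := count (fun v => 0 < mu v) vs.

Definition represents mu x :=
  [/\ forall v, v \in vs -> 0 <= mu v, \sum_(v <- vs) mu v = 1 &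
      \sum_(v <- vs) mu v *: v = x].

Lemma nb_active_le mu nu :
  (forall v, v \in vs -> 0 < nu v -> 0 < mu v) ->
  (nb_active nu <= nb_active mu)%N.
Proof. by move=> numu; apply: sub_in_count => v; exact: numu. Qed.

Lemma nb_active_leS mu nu w :
  (forall v, v \in vs -> v != w -> 0 < nu v -> 0 < mu v) ->
  (nb_active nu <= nb_active mu + 1)%N.
Proof.
move=> numu; have w1 : (count_mem w vs <= 1)%N.
  by rewrite count_uniq_mem // leq_b1.
apply: leq_trans (leq_add (leqnn _) w1); rewrite -count_predUI.
apply: leq_trans (leq_addr _ _); apply: sub_in_count => v vvs /= nuv.
by have [->|vw] := eqVneq v w; rewrite ?orbT // (numu v).
Qed.

Lemma nb_active_lt mu nu w : w \in vs -> 0 < mu w -> nu w = 0 ->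
  (forall v, v \in vs -> 0 < nu v -> 0 < mu v) ->
  (nb_active nu < nb_active mu)%N.
Proof.
move=> wvs muw nuw numu.
have w1 : count_mem w vs = 1%N by rewrite count_uniq_mem // wvs.
rewrite -addn1 -w1 -count_predUI.
rewrite [X in (_ + X)%N](_ : _ = 0%N) ?addn0.
  by apply: sub_in_count => v vvs /= /orP[/numu|/eqP->//]; exact.
apply/eqP; rewrite -leqn0 leqNgt -has_count; apply/hasPn => v vvs /=.
by apply/negP => /andP[nuv /eqP E]; rewrite E nuw ltxx in nuv.
Qed.

Lemma represents_active mu x : represents mu x ->
  exists2 v, v \in vs & 0 < mu v.
Proof.
move=> [mu0 mu1 _]; apply: contrapT => no; move: mu1.
rewrite big_seq big1 => [/eqP|v vvs]; first by rewrite eq_sym oner_eq0.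
apply/eqP; rewrite eq_le mu0 // andbT leNgt; apply/negP => muv.
by apply: no; exists v.
Qed.

Lemma nb_active_gt0 mu x : represents mu x -> (0 < nb_active mu)%N.
Proof.
by move=> /represents_active[v vvs muv]; rewrite -has_count; apply/hasP; exists v.
Qed.

Lemma represents_le1 mu x u : represents mu x -> u \in vs -> mu u <= 1.
Proof.
move=> [mu0 <- _] uvs; rewrite (bigD1_seq u) //= lerDl.
by rewrite big_seq_cond sumr_ge0 // => v /andP[/mu0].
Qed.

(** The other weights are nonnegative with sum zero. This excludes away steps at weight 1, where the
    maximal step length would divide by zero. *)
Lemma represents_eq1 mu x u : represents mu x -> u \in vs -> mu u = 1 -> x = u.
Proof.
move=> [mu0 mu1 <-] uvs muu; rewrite (bigD1_seq u) //= muu scale1r.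
rewrite big_seq_cond big1 ?addr0 // => v /andP[vvs vu].
move: mu1; rewrite (bigD1_seq u) //= muu => /eqP.
rewrite -subr_eq0 addrAC subrr add0r big_seq_cond psumr_eq0; last first.
  by move=> w /andP[/mu0].
by move=> /allP/(_ v vvs); rewrite vvs vu /= => /eqP ->; rewrite scale0r.
Qed.

Lemma sum_delta (W : lmodType R) (F : 'rV[R]_p -> W) w : w \in vs ->
  \sum_(v <- vs) (v == w)%:R *: F v = F w.
Proof.
move=> wvs; rewrite (bigD1_seq w) //= eqxx scale1r big1 ?addr0 // => v /negbTE->.
by rewrite scale0r.
Qed.

(* Both weight updates have this form: [e = gamma] with [w] the away vertex, or
   [e = - gamma] with [w] the Frank-Wolfe vertex. *)
Lemma represents_update mu nu x w (e : R) : represents mu x -> w \in vs ->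
  (forall v, v \in vs -> nu v = mu v * (1 + e) - e * (v == w)%:R) ->
  (forall v, v \in vs -> 0 <= nu v) ->
  represents nu (x + e *: (x - w)).
Proof.
move=> [_ mu1 mux] wvs nuE nu0; split => //.
  rewrite big_seq (eq_bigr _ nuE) -big_seq sumrB -mulr_suml mu1 mul1r -mulr_sumr.
  rewrite [X in e * X](eq_bigr (fun v => (v == w)%:R *: (1 : R^o))) => [|v _].
    by rewrite sum_delta // mulr1 addrK.
  by rewrite /GRing.scale /= mulr1.
rewrite big_seq (eq_bigr (fun v => (1 + e) *: (mu v *: v) -
    e *: ((v == w)%:R *: v))) => [|v vvs]; last first.
  by rewrite nuE // scalerBl !scalerA (mulrC (1 + e)).
rewrite -big_seq sumrB -!scaler_sumr mux sum_delta //.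
by rewrite scalerDl scale1r scalerBr addrA.
Qed.

End Representation.

Section Gap.
Context {R : realType} {m p : nat}.
Variables (C : 'M[R]_(m, p)) (d : 'cV[R]_m).
Local Notation P := (polyhedron C d).
Local Notation V := (vertices C d).
Variable vs : seq 'rV[R]_p.
Hypothesis vs_uniq : uniq vs.
Hypothesis vsP : forall v, v \in vs <-> V v.
Hypothesis zeta0 : 0 < zeta C d.
Hypothesis phi0 : 0 < phi C d.

Lemma represents_polyhedron mu x : represents vs mu x -> P x.
Proof.
move=> [mu0 mu1 <-]; apply: polyhedron_sum => // v /vsP.
exact: vertices_polyhedron.
Qed.

(* From the barycenter of the active vertices one can move in direction [y - x]
   by a length [Omega / nb_active mu] within [P]: an inactive constraint has
   slack at least [zeta / nb_active mu] there. *)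
Lemma barycenter_move mu x y (t : R) (U := [seq v <- vs | 0 < mu v]) :
  represents vs mu x -> P y -> 0 <= t ->
  t * phi C d * enorm (y - x) * (nb_active vs mu)%:R <= zeta C d ->
  P (\sum_(v <- U) (nb_active vs mu)%:R^-1 *: v + t *: (y - x)).
Proof.
move=> mux Py t0 ht i; have n0 := nb_active_gt0 mux.
set n := nb_active vs mu in ht n0 *.
have nR0 : (0 : R) < n%:R by rewrite ltr0n.
have Usize : size U = n by rewrite size_filter.
have UV v : v \in U -> V v by rewrite mem_filter => /andP[_ /vsP].
rewrite dotDr dotZr dot_sumr -mulr_sumr.
have dn : d i 0 = n%:R^-1 * \sum_(v <- U) d i 0.
  by rewrite big_const_seq count_predT Usize iter_addr_0 -(mulr_natl (d i 0)) mulKf // gt_eqF.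
have slackU v : v \in U -> 0 <= d i 0 - dot (row i C) v.
  by move=> /UV [Pv _]; rewrite subr_ge0.
(* If some active vertex is slack in constraint [i], it alone gives the barycenter the slack
   [zeta / n], the others contributing a nonnegative amount. Otherwise [x] is tight as well, and
   moving in the direction of a point of [P] cannot violate the constraint. *)
have [/hasP[w wU wi]|/hasPn tight] :=
    boolP (has (fun v => dot (row i C) v < d i 0) U).
  have slack : zeta C d <= \sum_(v <- U) (d i 0 - dot (row i C) v).
    rewrite (bigD1_seq w) ?filter_uniq //= -[leLHS]addr0 lerD //.
      by apply: zeta_le => //; exact: UV.
    by rewrite big_seq_cond sumr_ge0 // => v /andP[/slackU].
  have ai : ~ always_active C d i.
    by move=> /(_ w (UV _ wU)) E; rewrite E ltxx in wi.
  have czt : t * dot (row i C) (y - x) * n%:R <= zeta C d.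
    apply: le_trans ht; apply: ler_wpM2r; first exact: ltW.
    rewrite -mulrA; apply: ler_wpM2l => //; apply: le_trans (cauchy_schwarz _ _) _.
    by apply: ler_wpM2r; [exact: enorm_ge0|exact: enorm_row_le_phi].
  rewrite sumrB in slack; rewrite dn -lerBrDl -mulrBr [leRHS]mulrC.
  by rewrite ler_pdivlMr //; exact: le_trans czt slack.
have tightU v : v \in U -> dot (row i C) v = d i 0.
  move=> vU; apply/eqP; rewrite eq_le; have [-> _ /=] := UV v vU.
  by rewrite leNgt tight.
rewrite big_seq (eq_bigr (fun=> d i 0)) // -big_seq -dn gerDl.
have xi : dot (row i C) x = d i 0.
  have [mu0 mu1 <-] := mux; rewrite dot_sumr -[RHS]mul1r -mu1 mulr_suml.
  rewrite big_seq [RHS]big_seq; apply: eq_bigr => v vvs.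
  have [muv|] := ltP 0 (mu v); first by rewrite tightU // mem_filter muv.
  by move=> muv; rewrite (_ : mu v = 0) ?mul0r //; apply/le_anti; rewrite muv mu0.
by rewrite dotDr dotNr xi mulr_ge0_le0 // subr_le0; exact: Py.
Qed.

(** On the linear form of [g], [q] does at least as well as the shifted barycenter, and the
    barycenter at least as well as [u]; the shift accounts for the difference. *)
Lemma frank_wolfe_gap mu x y g q u (N : nat) : represents vs mu x -> P y ->
  (nb_active vs mu <= N)%N ->
  (forall z, P z -> dot g q <= dot g z) ->
  (forall v, v \in vs -> 0 < mu v -> dot g v <= dot g u) ->
  0 <= dot g (x - y) ->
  Omega C d / N%:R * dot g (x - y) <= dot g (u - q) * enorm (x - y).
Proof.
move=> mux Py nN qmin umax gxy.
have uq0 : 0 <= dot g (u - q).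
  rewrite dotDr dotNr subr_ge0; have [v vvs muv] := represents_active mux.
  apply: le_trans (umax v vvs muv); apply: qmin.
  by apply: vertices_polyhedron; apply/vsP.
have [xy|xy] := eqVneq x y.
  by rewrite xy subrr dot0r mulr0 mulr_ge0 ?enorm_ge0.
have r0 : 0 < enorm (x - y) by rewrite enorm_gt0 subr_eq0.
have n0 := nb_active_gt0 mux.
pose U := [seq v <- vs | 0 < mu v].
have Usize : size U = nb_active vs mu by rewrite size_filter.
set n := nb_active vs mu in nN n0 Usize *.
have nR0 : (0 : R) < n%:R by rewrite ltr0n.
have rE : enorm (y - x) = enorm (x - y).
  by rewrite /enorm -opprB dotNl dotNr opprK.
(* The largest length that [barycenter_move] allows: its hypothesis becomes an equality. *)
pose t := Omega C d / n%:R / enorm (x - y).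
have W0 : 0 < Omega C d by rewrite divr_gt0.
have t0 : 0 <= t by rewrite /t !divr_ge0 ?ltW.
have Pb : P (\sum_(v <- U) n%:R^-1 *: v + t *: (y - x)).
  apply: barycenter_move => //; rewrite -/n rE /t /Omega.
  rewrite le_eqVlt; apply/orP; left; apply/eqP; field.
  by rewrite !gt_eqF.
have gb : dot g (\sum_(v <- U) n%:R^-1 *: v) <= dot g u.
  rewrite dot_sumr -mulr_sumr mulrC ler_pdivrMr // mulr_natr -Usize.
  rewrite -[leRHS]iter_addr_0 -(count_predT U) -big_const_seq.
  rewrite big_seq [leRHS]big_seq; apply: ler_sum => v.
  by rewrite mem_filter => /andP[muv vvs]; exact: umax.
have key : t * dot g (x - y) <= dot g (u - q).
  have := qmin _ Pb; rewrite (dotDr g (\sum_(v <- U) _)) dotZr -(opprB x y) dotNr.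
  by rewrite (dotDr g u) (dotNr g q); lra.
rewrite -ler_pdivrMr // mulrAC; apply: le_trans key; rewrite /t.
apply: ler_wpM2r => //; apply: ler_wpM2r; first by rewrite invr_ge0 ltW.
by rewrite ler_pM2l // lef_pV2 ?posrE ?ler_nat // ltr0n (leq_trans n0).
Qed.

End Gap.

(** * One iteration *)

Section LineSearch.
Context {R : realType} {p : nat}.
Variables (f : 'rV[R]_p -> R) (L : R).
Hypothesis L0 : 0 < L.
Hypothesis fL : quadratic_upper L f.
Implicit Types (x v : 'rV[R]_p).

Lemma quadratic_upper_line x v (t : R) :
  f (x + t *: v) <= f x + t * dot (grad f x) v + L / 2 * t ^+ 2 * dot v v.
Proof.
apply: le_trans (fL x _) _; rewrite (addrAC x) subrr add0r enorm_sq.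
by rewrite !dotZr dotZl; lra.
Qed.

(** The sum of the upper bounds from [x] to [y] and from [y] to [x]. *)
Lemma quadratic_upper_monotone x y :
  dot (grad f y - grad f x) (y - x) <= L * dot (y - x) (y - x).
Proof.
have := fL x y; have := fL y x; rewrite !enorm_sq -(opprB y x).
by rewrite (dotDl (grad f y)) !(dotNl, dotNr) opprK; lra.
Qed.

(** For nonzero [v], the minimizer along [v] of the quadratic upper bound, clipped at [tmax]. *)
Definition short_step x v (tmax : R) :=
  if v == 0 then 0 else
  Num.min (- dot (grad f x) v / (L * enorm v ^+ 2)) tmax.

Lemma short_step_bounds x v tmax : dot (grad f x) v <= 0 -> 0 <= tmax ->
  0 <= short_step x v tmax <= tmax.
Proof.
move=> gv t0; rewrite /short_step; case: eqVneq => [_|v0]; first by rewrite lexx.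
by rewrite le_min t0 ge_min lexx orbT andbT divr_ge0 ?oppr_ge0 //
   mulr_ge0 ?sqr_ge0 // ltW.
Qed.

Lemma unclipped_decrease x v tmax : v != 0 ->
  - dot (grad f x) v <= L * dot v v * tmax ->
  f (x + short_step x v tmax *: v) <=
    f x - dot (grad f x) v ^+ 2 / (2 * L * dot v v).
Proof.
move=> v0 H; have vv : 0 < dot v v by rewrite lt_def dot_ge0 dot_eq0 v0.
have Lv : 0 < L * dot v v by rewrite mulr_gt0.
rewrite /short_step (negbTE v0) enorm_sq.
rewrite min_l; last by rewrite ler_pdivrMr // mulrC.
apply: le_trans (quadratic_upper_line _ _ _) _.
rewrite le_eqVlt; apply/orP; left; apply/eqP; field.
by rewrite !gt_eqF.
Qed.

(** Up to the minimizer of the quadratic bound, the second-order term eats at most half of the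
    first-order decrease. *)
Lemma clipped_decrease x v tmax : v != 0 -> 0 <= tmax ->
  L * dot v v * tmax <= - dot (grad f x) v ->
  short_step x v tmax = tmax /\
  f (x + tmax *: v) <= f x + tmax * dot (grad f x) v / 2.
Proof.
move=> v0 t0 H; have vv : 0 < dot v v by rewrite lt_def dot_ge0 dot_eq0 v0.
have Lv : 0 < L * dot v v by rewrite mulr_gt0.
rewrite /short_step (negbTE v0) enorm_sq; split.
  by rewrite min_r // ler_pdivlMr // mulrC.
apply: le_trans (quadratic_upper_line _ _ _) _.
have := ler_wpM2l t0 H; lra.
Qed.

(* The directional derivative along [v] stays negative up to [tmax]. *)
Lemma clipped_line_search x v tmax t : v != 0 -> 0 <= t < tmax ->
  L * dot v v * tmax <= - dot (grad f x) v ->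
  f (x + tmax *: v) < f (x + t *: v).
Proof.
move=> v0 /andP[t0 tt] H.
have vv : 0 < dot v v by rewrite lt_def dot_ge0 dot_eq0 v0.
have Lv : 0 < L * dot v v by rewrite mulr_gt0.
set g := dot (grad f x) v in H; pose g' := dot (grad f (x + t *: v)) v.
have g'g : g' <= g + t * (L * dot v v).
  have [t00|t00] := eqVneq t 0.
    by rewrite /g' t00 scale0r mul0r !addr0.
  have t0' : 0 < t by rewrite lt_def t00.
  have := quadratic_upper_monotone x (x + t *: v).
  rewrite (addrAC x) subrr add0r !dotZr dotZl dotDl dotNl -/g -/g' => K.
  have : t * (g' - g) <= t * (t * (L * dot v v)) by lra.
  rewrite ler_pM2l //; lra.
have -> : x + tmax *: v = x + t *: v + (tmax - t) *: v.
  by rewrite -addrA -scalerDl addrCA subrr addr0.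
apply: le_lt_trans (quadratic_upper_line _ _ _) _; rewrite -/g'.
rewrite -addrA gtrDl.
suff : (tmax - t) * (g' + L / 2 * (tmax - t) * dot v v) < 0 by lra.
rewrite pmulr_rlt0 ?subr_gt0 //.
have : L * dot v v * t < L * dot v v * tmax by rewrite ltr_pM2l.
by lra.
Qed.

End LineSearch.

Section Progress.
Context {R : realType} {p : nat}.
Variables (f : 'rV[R]_p -> R) (L s : R).
Hypothesis L0 : 0 < L.
Hypothesis s0 : 0 < s.
Hypothesis fL : quadratic_upper L f.
Hypothesis fs : quadratic_lower s f.
Implicit Types (x y q u v : 'rV[R]_p).

Lemma suboptimality_gap x y : f x - f y <= dot (grad f x) (x - y).
Proof.
have := fs x y; have := mulr_ge0 (ltW s0) (sqr_ge0 (enorm (y - x))).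
by rewrite -(opprB x y) dotNr; lra.
Qed.

(** Here [G] stands for the pairwise gap, [k] for [Omega / N] and [D] for the diameter. The decrease
    is at least [G ^+ 2 / (8 * L * D ^+ 2)]; the gap inequality bounds [G] below by the slope
    towards [y] over the distance, and strong convexity bounds the square of that ratio below by
    [2 * s * (f x - f y)]. *)
Lemma unclipped_progress x y v (tmax G k D r : R) :
  f y < f x -> 0 < k -> k * dot (grad f x) (x - y) <= G * enorm (x - y) ->
  enorm v <= D -> 16 * r * L * D ^+ 2 <= k ^+ 2 * s -> v != 0 ->
  G / 2 <= - dot (grad f x) v -> - dot (grad f x) v <= L * dot v v * tmax ->
  f (x + short_step f L x v tmax *: v) <= f x - r * (f x - f y).
Proof.
move=> h k0 gap vD rL v0 Gv uncl.
apply: le_trans (unclipped_decrease L0 fL v0 uncl) _; rewrite lerD2l lerN2.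
have vv : 0 < dot v v by rewrite lt_def dot_ge0 dot_eq0 v0.
have low := fs x y; set rr := enorm (x - y) in gap.
have rrE : enorm (y - x) = rr by rewrite /rr /enorm -opprB dotNl dotNr opprK.
have rr0 : 0 < rr.
  by rewrite enorm_gt0 subr_eq0; apply/eqP => E; rewrite E ltxx in h.
rewrite -(opprB x y) dotNr (opprB x y) rrE in low.
set g1 := dot (grad f x) (x - y) in gap low.
have h0 : 0 < f x - f y by rewrite subr_gt0.
set hh := f x - f y in h0 *; set dd := dot (grad f x) v in Gv uncl *.
have g1h : hh + s / 2 * rr ^+ 2 <= g1 by rewrite /hh; lra.
(* AM-GM: [(h + s r^2 / 2)^2 >= 2 s h r^2] *)
have amgm : 2 * s * hh * rr ^+ 2 <= (hh + s / 2 * rr ^+ 2) ^+ 2.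
  by have := sqr_ge0 (hh - s / 2 * rr ^+ 2); lra.
have b0 : 0 <= hh + s / 2 * rr ^+ 2.
  by rewrite addr_ge0 ?mulr_ge0 ?sqr_ge0 ?divr_ge0 // ltW.
have g10 : 0 <= g1 by exact: le_trans b0 g1h.
have g1sq : 2 * s * hh * rr ^+ 2 <= g1 ^+ 2.
  by apply: le_trans amgm _; rewrite ler_sqr ?nnegrE.
have G0 : 0 <= G.
  have : 0 <= G * rr by apply: le_trans gap; rewrite mulr_ge0 // ltW.
  by rewrite pmulr_lge0.
have Gsq : k ^+ 2 * (2 * s * hh) <= G ^+ 2.
  rewrite -(ler_pM2r (exprn_gt0 2 rr0)) -[leRHS]exprMn.
  have K : (k * g1) ^+ 2 <= (G * rr) ^+ 2.
    by rewrite ler_sqr ?nnegrE ?mulr_ge0 // ltW.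
  by apply: le_trans K; rewrite exprMn -(mulrA (k ^+ 2)) ler_pM2l ?exprn_gt0.
have ddsq : (G / 2) ^+ 2 <= dd ^+ 2.
  by rewrite -[leRHS]sqrrN ler_sqr ?nnegrE ?divr_ge0 // (le_trans _ Gv) ?divr_ge0.
have vD2 : dot v v <= D ^+ 2.
  rewrite -enorm_sq ler_sqr ?nnegrE ?enorm_ge0 //.
  exact: le_trans (enorm_ge0 _) vD.
rewrite ler_pdivlMr ?mulr_gt0 //; apply: le_trans ddsq.
(* Replacing [dot v v] by [D ^+ 2] has the right sign only for positive [r]. *)
have [r0|r0] := leP r 0.
  apply: le_trans (sqr_ge0 _); rewrite mulr_le0_ge0 //.
    by rewrite mulr_le0_ge0 // ltW.
  by rewrite ltW // !mulr_gt0.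
have : r * hh * (2 * L * dot v v) <= r * hh * (2 * L * D ^+ 2).
  by rewrite ler_pM2l ?mulr_gt0 // ler_pM2l ?mulr_gt0.
have := ler_wpM2l (ltW h0) rL.
have : 0 <= k ^+ 2 * (s * hh) by rewrite mulr_ge0 ?sqr_ge0 // mulr_ge0 // ltW.
lra.
Qed.

End Progress.

Section Step.
Context {R : realType} {m p n : nat}.
Variables (C : 'M[R]_(m, p)) (d : 'cV[R]_m).
Variables (f : 'I_n -> 'rV[R]_p -> R) (L : 'I_n -> R) (caratheodory : bool).
Local Notation P := (polyhedron C d).
Local Notation V := (vertices C d).
Local Notation vs := (enum_fset (fset_set V)).
Local Notation N := (nb_vertices C d caratheodory).
Implicit Types (mu nu : 'rV[R]_p -> R) (x y q u v w : 'rV[R]_p).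

Let vs_uniq : uniq vs := fset_uniq _.

Lemma mem_vertices v : v \in vs <-> V v.
Proof.
rewrite -[v \in _]/(v \in fset_set V) in_fset_set; last exact: finite_vertices.
by split; [move/set_mem|move/mem_set].
Qed.

Let vsP := mem_vertices.

(** Weights other than that of [u] are scaled by a positive factor, so no vertex becomes active; the
    maximal length is where the weight of [u] reaches zero. *)
Lemma update_weights_away mu x q u (t : R) : represents vs mu x ->
  u \in vs -> mu u < 1 -> 0 <= t <= mu u / (1 - mu u) ->
  let nu := update_weights true q u t mu in
  [/\ represents vs nu (x + t *: (x - u)),
      0 < mu u -> (nb_active vs nu <= nb_active vs mu)%N &
      0 < mu u -> t = mu u / (1 - mu u) ->
        (nb_active vs nu < nb_active vs mu)%N].
Proof.
move=> mux uvs mu1 /andP[t0 t1] nu; have [mu0 _ _] := mux.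
have mu1' : 0 < 1 - mu u by rewrite subr_gt0.
rewrite ler_pdivlMr // in t1.
have nuE v : v \in vs -> nu v = mu v * (1 + t) - t * (v == u)%:R.
  rewrite /nu /update_weights => _; case: eqVneq => [->|_]; first by rewrite mulr1.
  by rewrite mulr0 subr0.
have act v : v \in vs -> 0 < mu u -> 0 < nu v -> 0 < mu v.
  move=> vvs muu; rewrite /nu /update_weights; case: eqVneq => [->//|_].
  by rewrite pmulr_lgt0 // ltr_wpDr.
split.
- apply: (represents_update vs_uniq mux uvs nuE) => v vvs; rewrite nuE //.
  case: eqVneq => [->|_]; first by rewrite mulr1; lra.
  by rewrite mulr0 subr0 mulr_ge0 ?mu0 // addr_ge0.
- by move=> muu; apply: nb_active_le => v vvs; exact: act.
- move=> muu tE; apply: (nb_active_lt vs_uniq uvs muu).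
    by rewrite nuE // eqxx mulr1 tE; field; rewrite gt_eqF.
  by move=> v vvs; exact: act.
Qed.

Lemma update_weights_toward mu x q u (t : R) : represents vs mu x ->
  q \in vs -> 0 <= t <= 1 ->
  let nu := update_weights false q u t mu in
  represents vs nu (x + t *: (q - x)) /\
  (nb_active vs nu <= nb_active vs mu + 1)%N.
Proof.
move=> mux qvs /andP[t0 t1] nu; have [mu0 _ _] := mux.
have nuE v : v \in vs -> nu v = mu v * (1 + - t) - - t * (v == q)%:R.
  rewrite /nu /update_weights => _; case: eqVneq => [->|_].
    by rewrite mulr1 opprK.
  by rewrite mulr0 subr0.
have t1' : 0 <= 1 - t by rewrite subr_ge0.
split.
  rewrite -(opprB x q) scalerN -scaleNr; apply: (represents_update vs_uniq mux qvs nuE) => v vvs.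
  by rewrite nuE // mulNr opprK addr_ge0 ?mulr_ge0 ?mu0.
apply: (nb_active_leS vs_uniq (w := q)) => v vvs vq.
rewrite /nu /update_weights (negbTE vq) => nuv; rewrite lt_def mu0 // andbT.
by apply/eqP => muv; rewrite muv mul0r ltxx in nuv.
Qed.

(** The reduction only removes active vertices, so a vertex dropped by an away step stays
    dropped. *)
Lemma caratheodory_represents x nu mu : caratheodory_reduction V x nu mu ->
  [/\ represents vs mu x, (nb_active vs mu <= nb_active vs nu)%N &
      (nb_active vs mu <= p.+1)%N].
Proof.
have fV := finite_vertices C d; move=> [mu0 sub card mu1 mux].
rewrite fsbig_finite // in mu1; rewrite fsbig_finite // in mux.
split.
- by split=> // v /vsP; exact: mu0.
- apply: nb_active_le => v /vsP Vv muv.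
  by have [] : active_vertices V nu v by apply: sub.
- apply: leq_trans (geq_card_fset_set card).
  rewrite /nb_active -size_filter; apply: uniq_leq_size.
    by rewrite filter_uniq.
  move=> v; rewrite mem_filter => /andP[muv /vsP Vv].
  rewrite -[v \in _]/(v \in fset_set (active_vertices V mu)) in_fset_set.
    exact/mem_set.
  by apply: sub_finite_set fV => w [].
Qed.

Hypothesis cP : compact P.
Hypothesis zeta0 : 0 < zeta C d.
Hypothesis phi0 : 0 < phi C d.

(** Three cases: an unclipped step contracts by [unclipped_progress], a clipped away step drops a
    vertex, and a clipped Frank-Wolfe step has length 1 and halves the suboptimality, whence
    [r <= 1 / 2]. *)
Lemma asfw_step_progress (b : nat) (xi : nat -> 'I_n) (s r : R) x mu x' mu' :
  let h := batch_objective f b xi in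
  let Lb := batch_lipschitz L b xi in
  0 < Lb -> 0 < s -> quadratic_upper Lb h -> quadratic_lower s h ->
  r <= 1 / 2 ->
  16 * r * Lb * diameter C d ^+ 2 <= (Omega C d / N%:R) ^+ 2 * s ->
  represents vs mu x -> (nb_active vs mu <= N)%N ->
  asfw_step P V f L caratheodory b xi x mu x' mu' ->
  [/\ represents vs mu' x', (nb_active vs mu' <= N)%N,
      h x' <= h x, (nb_active vs mu' <= nb_active vs mu + 1)%N &
      forall y, P y -> h y < h x ->
        h x' - h y <= (1 - r) * (h x - h y) \/
        (nb_active vs mu' < nb_active vs mu)%N].
Proof.
move=> h Lb Lb0 s0 hL hs r12 rL mux muN [q [u [t [[Vq qmin] [[Vu muu] umax] [tE -> muE]]]]].
rewrite -/h in qmin umax tE muE *; rewrite -/Lb in tE.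
set g := grad h x in qmin umax tE muE *.
set away := 0 < dot g (q + u - 2 *: x) in tE muE *.
set dir := if away then x - u else q - x in tE muE *.
set tmax := if away then _ else 1 in tE *.
set nu := update_weights away q u t mu in muE.
have qvs : q \in vs by apply/vsP.
have uvs : u \in vs by apply/vsP.
have Px : P x by exact: represents_polyhedron vsP _ _ mux.
have Pu : P u by exact: vertices_polyhedron Vu.
have awayE : away -> 0 < dot g (q - x) + dot g (u - x).
  by rewrite /away scaler_nat mulr2n -dotDr; congr (_ < dot g _);
     rewrite opprD addrACA.
have gqx : dot g (q - x) <= 0 by rewrite dotDr dotNr subr_le0; exact: qmin.
have muu1 : away -> mu u < 1.
  move=> aw; rewrite lt_neqAle (represents_le1 vs_uniq mux uvs) andbT.
  apply/eqP => /(represents_eq1 vs_uniq mux uvs) xu.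
  by have := awayE aw; rewrite -xu subrr dot0r addr0 ltNge gqx.
have tmax0 : 0 <= tmax.
  rewrite /tmax; case: ifP => // aw; rewrite divr_ge0 ?ltW // subr_gt0.
  exact: muu1.
(* The slopes of the two candidate directions add up to the pairwise gap, and the test picks the
   steeper one. *)
have gdir : dot g (u - q) / 2 <= - dot g dir.
  rewrite /dir; have := awayE; rewrite /away; case: ltP => [_ /(_ isT)|K _].
    by rewrite !dotDr !dotNr; lra.
  by move: K; rewrite dotDr dotNr dotZr !dotDr !dotNr; lra.
have G0 : 0 <= dot g (u - q).
  by rewrite dotDr dotNr subr_ge0; exact: qmin.
have gdir0 : dot g dir <= 0.
  by rewrite -oppr_ge0; apply: le_trans gdir; rewrite divr_ge0.
have short := short_step_bounds Lb0 gdir0 tmax0.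
have t01 : 0 <= t <= tmax by case: tE => [->//|[]].
(* Line search does at least as well as the short step, so decrease is only estimated for the
   latter. *)
have tshort : h (x + t *: dir) <= h (x + short_step h Lb x dir tmax *: dir).
  by case: tE => [->|[_ tmin]]; rewrite ?lexx // tmin.
have descent : h (x + t *: dir) <= h x.
  apply: le_trans tshort _.
  have [dir0|dir0] := eqVneq dir 0; first by rewrite dir0 scaler0 addr0.
  have [cl|/ltW cl] := leP (Lb * dot dir dir * tmax) (- dot g dir).
    have [-> K] := clipped_decrease Lb0 hL dir0 tmax0 cl.
    apply: le_trans K _; rewrite gerDl -mulrA.
    by rewrite mulr_ge0_le0 // mulr_le0_ge0.
  apply: le_trans (unclipped_decrease Lb0 hL dir0 cl) _.
  rewrite gerDl oppr_le0 divr_ge0 ?sqr_ge0 // mulr_ge0 ?dot_ge0 //.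
  by rewrite mulr_ge0 // ltW.
have [nux nuS nudrop] : [/\ represents vs nu (x + t *: dir),
    (nb_active vs nu <= nb_active vs mu + 1)%N &
    away -> t = tmax -> (nb_active vs nu < nb_active vs mu)%N].
  rewrite /nu /dir; rewrite /tmax in t01 *.
  case: (boolP away) t01 muu1 => aw t01 muu1.
    have [nux nule nult] := update_weights_away q mux uvs (muu1 isT) t01.
    by split=> // [|_ tE']; [rewrite (leq_trans (nule muu)) ?leq_addr|exact: nult].
  by have [nux nule] := update_weights_toward u mux qvs t01.
have [mux' mu'nu mu'N] : [/\ represents vs mu' (x + t *: dir),
    (nb_active vs mu' <= nb_active vs nu)%N & (nb_active vs mu' <= N)%N].
  rewrite /nb_vertices; case: caratheodory muE => [/caratheodory_represents[]//|E].
  have E' v : v \in vs -> mu' v = nu v by move=> /vsP; exact: E.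
  split.
  - have [nu0 nu1 nusum] := nux; split=> [v vvs||].
    + by rewrite E' // nu0.
    + by rewrite -nu1 big_seq [RHS]big_seq; apply: eq_bigr => v vvs; rewrite E'.
    + rewrite -nusum big_seq [RHS]big_seq.
      by apply: eq_bigr => v vvs; rewrite E'.
  - by apply: nb_active_le => v vvs; rewrite E'.
  - exact: count_size.
split=> //; first exact: leq_trans mu'nu nuS.
move=> y Py hxy; have gxy : h x - h y <= dot g (x - y).
  exact: suboptimality_gap s0 hs x y.
have hxy0 : 0 < h x - h y by rewrite subr_gt0.
have N0 : (0 < N)%N by apply: leq_trans muN; exact: nb_active_gt0 mux.
have k0 : 0 < Omega C d / N%:R by rewrite !divr_gt0 ?ltr0n.
have gap := frank_wolfe_gap vs_uniq vsP zeta0 phi0 mux Py muN qmin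
  (fun v vvs muv => umax v (conj (proj1 (vsP v) vvs) muv))
  (ltW (lt_le_trans hxy0 gxy)).
have dirD : enorm dir <= diameter C d.
  rewrite /dir; case: ifP => _; apply: le_diameter => //.
  exact: vertices_polyhedron.
have dir0 : dir != 0.
  apply/eqP => E; move: gdir; rewrite E dot0r oppr0 => K.
  have K' : dot g (u - q) * enorm (x - y) <= 0.
    by rewrite mulr_le0_ge0 ?enorm_ge0 //; lra.
  have := le_trans gap K'; rewrite leNgt => /negP; apply.
  by rewrite mulr_gt0 //; exact: lt_le_trans hxy0 gxy.
have [cl|/ltW cl] := leP (Lb * dot dir dir * tmax) (- dot g dir); last first.
  left; have := unclipped_progress Lb0 s0 hL hs hxy k0 gap dirD rL dir0 gdir cl.
  by move: tshort; lra.
have [stE K] := clipped_decrease Lb0 hL dir0 tmax0 cl.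
have [aw|naw] := boolP away.
  right; apply: leq_ltn_trans mu'nu _; apply: nudrop => //.
  (* Under line search the drop requires [t = tmax] exactly: any smaller [t] is strictly worse by
     [clipped_line_search]. *)
  case: tE => [->//|[/andP[t0 tt] tmin]].
  apply/eqP; rewrite eq_le tt leNgt /=; apply/negP => tlt.
  have := clipped_line_search Lb0 hL dir0 (_ : 0 <= t < tmax) cl.
  rewrite t0 tlt => /(_ isT); rewrite ltNge => /negP; apply.
  by apply: tmin; rewrite tmax0 lexx.
left; move: tshort K; rewrite stE /tmax (negbTE naw) mul1r => A1 A2.
have gd : h x - h y <= - dot g dir.
  apply: le_trans gxy _; rewrite /dir (negbTE naw) !dotDr !dotNr.
  by have := qmin y Py; lra.
have : r * (h x - h y) <= 1 / 2 * (h x - h y) by rewrite ler_pM2r.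
lra.
Qed.

End Step.

(** * Expectations *)

Section Mean.
Context {R : realType} {disp : measure_display} {T : measurableType disp}.
Variable Pr : probability T R.
Implicit Types (X Y : T -> R) (a e : R).

(** Integrability and a real value travel together, so linearity composes without side conditions on
    extended reals. *)
Definition has_mean Y e :=
  Pr.-integrable setT (EFin \o Y) /\ (\int[Pr]_w (Y w)%:E)%E = e%:E.

Lemma has_mean_cst a : has_mean (fun=> a) a.
Proof.
split; first exact: finite_measure_integrable_cst.
have /= -> := @integral_cst _ T R Pr setT measurableT a%:E.
by rewrite [X in (_ * X)%E]probability_setT mule1.
Qed.

Lemma has_meanD X Y a e : has_mean X a -> has_mean Y e ->
  has_mean (fun w => X w + Y w) (a + e).
Proof.
move=> [iX mX] [iY mY]; split.
  have -> : EFin \o (fun w => X w + Y w) = ((EFin \o X) \+ (EFin \o Y))%E.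
    by apply/funext.
  exact: integrableD.
by rewrite EFinD -mX -mY; exact: integralD_EFin.
Qed.

Lemma has_meanZ c Y e : has_mean Y e -> has_mean (fun w => c * Y w) (c * e).
Proof.
move=> [iY mY]; split; first exact: (integrableZl measurableT c iY).
by rewrite EFinM -mY; exact: (integralZl measurableT iY c).
Qed.

Lemma has_mean_indic (A : set T) : measurable A ->
  has_mean (\1_A) (fine (Pr A)).
Proof.
move=> mA; split; first exact: integrable_indic.
by rewrite integral_indic // setIT fineK // fin_num_measure.
Qed.

Lemma has_mean_sum (I : Type) (s : seq I) (Y : I -> T -> R) (e : I -> R) :
  (forall i, has_mean (Y i) (e i)) ->
  has_mean (fun w => \sum_(i <- s) Y i w) (\sum_(i <- s) e i).
Proof.
move=> Ye; elim: s => [|i s IHs].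
  have -> : (fun w => \sum_(i <- [::]) Y i w) = fun=> 0.
    by apply/funext => w; rewrite big_nil.
  by rewrite big_nil; exact: has_mean_cst.
have -> : (fun w => \sum_(i <- i :: s) Y i w) =
    fun w => Y i w + \sum_(i <- s) Y i w.
  by apply/funext => w; rewrite big_cons.
by rewrite big_cons; exact: has_meanD.
Qed.

(* [X] need not be measurable: the integral of a nonnegative function is a
   supremum over the simple functions below it. *)
Lemma expectation_le_mean X Y e : (forall w, 0 <= X w <= Y w) ->
  has_mean Y e -> ('E_Pr[X] <= e%:E)%E.
Proof.
move=> XY [_ <-]; have X0 w : 0 <= X w by case/andP: (XY w).
have Y0 w : 0 <= Y w by case/andP: (XY w) => /le_trans; apply.
rewrite unlock !ge0_integralTE; last 2 first.
- by move=> w; rewrite lee_fin.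
- by move=> w; rewrite lee_fin.
apply: ereal_sup_le => _ /= [h hX <-]; exists h => // w.
by apply: le_trans (hX w) _; rewrite lee_fin; case/andP: (XY w).
Qed.

Lemma has_mean_frequency_variance (b : nat) (A : 'I_b -> set T) (c : R) :
  (0 < b)%N -> (forall l, measurable (A l)) -> (forall l, Pr (A l) = c%:E) ->
  (forall l l', l != l' -> Pr (A l `&` A l') = (c * c)%:E) ->
  has_mean (fun w => (b%:R^-1 * (\sum_(l < b) \1_(A l) w) - c) ^+ 2)
           ((c - c ^+ 2) / b%:R).
Proof.
move=> b0 mA PA PAA.
have bR0 : (b%:R : R) != 0 by rewrite pnatr_eq0 -lt0n.
(* The summand is the product of two centered indicators, expanded; its mean vanishes off the
   diagonal by pairwise independence. *)
have mean_pair l l' : has_mean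
    (fun w => \1_(A l `&` A l') w + (- c * \1_(A l) w +
              (- c * \1_(A l') w + c ^+ 2)))
    ((l == l')%:R * (c - c ^+ 2)).
  have -> : (l == l')%:R * (c - c ^+ 2) =
      fine (Pr (A l `&` A l')) + (- c * fine (Pr (A l)) +
        (- c * fine (Pr (A l')) + c ^+ 2)).
    rewrite !PA /=; case: eqVneq => [->|ll'].
      by rewrite setIid PA /=; ring.
    by rewrite PAA //=; ring.
  apply: has_meanD; first by apply: has_mean_indic; exact: measurableI.
  apply: has_meanD; first by apply: has_meanZ; exact: has_mean_indic.
  apply: has_meanD; last exact: has_mean_cst.
  by apply: has_meanZ; exact: has_mean_indic.
have := has_meanZ (b%:R^-1 ^+ 2) (has_mean_sum (index_enum 'I_b) (fun l =>
  has_mean_sum (index_enum 'I_b) (mean_pair l))).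
have -> : b%:R^-1 ^+ 2 *
    (\sum_(l < b) \sum_(l' < b) (l == l')%:R * (c - c ^+ 2)) =
    (c - c ^+ 2) / b%:R.
  rewrite (eq_bigr (fun=> c - c ^+ 2)) => [|l _].
    by rewrite sumr_const card_ord -[(c - _) *+ b]mulr_natr; field.
  rewrite (bigD1 l) //= eqxx mul1r big1 ?addr0 // => l' /negbTE.
  by rewrite eq_sym => ->; rewrite mul0r.
have E (w : T) : (b%:R^-1 * (\sum_(l < b) \1_(A l) w) - c) ^+ 2 =
    b%:R^-1 ^+ 2 * \sum_(l < b) \sum_(l' < b)
      (\1_(A l `&` A l') w + (- c * \1_(A l) w +
              (- c * \1_(A l') w + c ^+ 2))).
  have -> : b%:R^-1 * (\sum_(l < b) \1_(A l) w) - c =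
      b%:R^-1 * \sum_(l < b) (\1_(A l) w - c).
    by rewrite sumrB sumr_const card_ord -[c *+ b]mulr_natr; field.
  rewrite exprMn [X in _ * X = _]expr2 mulr_suml; congr (_ * _).
  apply: eq_bigr => l _; rewrite mulr_sumr; apply: eq_bigr => l' _.
  by rewrite indicI /=; ring.
by rewrite (_ : (fun w => b%:R^-1 ^+ 2 * _) =
  fun w => (b%:R^-1 * (\sum_(l < b) \1_(A l) w) - c) ^+ 2) //;
  apply/funext => w; rewrite E.
Qed.

End Mean.

(** * Amortized contraction and geometric rates *)

Section Recursion.
Context {R : realType}.

(* [nb] is a potential that pays for the steps without contraction: it increases
   by at most one at each contracting step, so these are at least half of all. *)
Lemma amortized_contraction (a err : nat -> R) (nb : nat -> nat) (r : R) :
  0 < r -> nb 1%N = 1%N -> (forall k, (1 <= k)%N -> (0 < nb k)%N) ->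
  r <= 1 -> (forall k, (1 <= k)%N -> 0 <= err k) ->
  0 <= a 1%N ->
  (forall k, (1 <= k)%N ->
    (a k.+1 <= r * a k + err k /\ (nb k.+1 <= nb k + 1)%N) \/
    (a k.+1 <= a k + err k /\ (nb k.+1 < nb k)%N)) ->
  forall k, a k.+1 <= Num.sqrt r ^+ k *
    (a 1%N + \sum_(1 <= j < k.+1) err j / r ^+ j).
Proof.
move=> r0 nb1 nb0 r1 err0 a0 step k.
(* [c] counts the contracting steps among the first [k]. Such a step raises both sides of the second
   invariant by at most 2; any other step adds one to [k] and takes at least one from [nb]. As [nb]
   is positive, [k <= c.*2]. *)
suff [c [ck kc ac]] : exists c, [/\ (c <= k)%N, (nb k.+1 + k <= c.*2 + 1)%N &
    a k.+1 <= r ^+ c * (a 1%N + \sum_(1 <= j < k.+1) err j / r ^+ j)].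
  apply: le_trans ac _; apply: ler_wpM2r.
    rewrite addr_ge0 // big_nat_cond sumr_ge0 // => j /andP[/andP[j1 _] _].
    by rewrite divr_ge0 ?err0 // exprn_ge0 // ltW.
  have -> : r ^+ c = Num.sqrt r ^+ c.*2.
    by rewrite -mul2n exprM sqr_sqrtr // ltW.
  apply: ler_wiXn2l; rewrite ?sqrtr_ge0 //.
    by rewrite -sqrtr1 ler_wsqrtr.
  have := nb0 k.+1 isT; move: kc; lia.
elim: k => [|k [c [ck kc ac]]].
  by exists 0%N; rewrite nb1 big_geq // addr0 expr0 mul1r.
have rk0 j : 0 < r ^+ j by rewrite exprn_gt0.
have ek : 0 <= err k.+1 by exact: err0.
set S := \sum_(1 <= j < k.+1) _ in ac.
have SE : \sum_(1 <= j < k.+2) err j / r ^+ j = S + err k.+1 / r ^+ k.+1.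
  by rewrite big_nat_recr.
(* A new error enters undiscounted; dividing it by [r ^+ k.+1] compensates for the common factor
   [r ^+ c']. *)
have pay (c' : nat) : (c' <= k.+1)%N -> err k.+1 <= r ^+ c' * (err k.+1 / r ^+ k.+1).
  move=> c'k; rewrite mulrCA -[leLHS]mulr1; apply: ler_wpM2l => //.
  by rewrite ler_pdivlMr // mul1r ler_wiXn2l // ltW.
have [[ak nbk]|[ak nbk]] := step k.+1 isT; [exists c.+1|exists c]; split.
- by [].
- by move: nbk kc; lia.
- apply: le_trans ak _; rewrite SE addrA mulrDr lerD ?pay //.
  by rewrite exprS -mulrA ler_pM2l.
- exact: leqW.
- by move: nbk kc; lia.
- by apply: le_trans ak _; rewrite SE addrA mulrDr lerD ?pay // leqW.
Qed.

(** This is [k * q ^+ k <= 1 + q + ... + q ^+ (k - 1)] multiplied by [1 - q]. *)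
Lemma mul_nat_geometric_le (q : R) (k : nat) : 0 <= q <= 1 ->
  k%:R * q ^+ k * (1 - q) <= 1 - q ^+ k.
Proof.
move=> /andP[q0 q1]; elim: k => [|k IHk]; first by rewrite mul0r mul0r expr0 subrr.
have qk : 0 <= q ^+ k by rewrite exprn_ge0.
have qk1 : q ^+ k <= 1 by rewrite exprn_ile1.
have := ler_wpM2l q0 IHk; rewrite exprS -natr1.
have : 0 <= (1 - q) * (1 - q * q ^+ k).
  by rewrite mulr_ge0 ?subr_ge0 // mulr_ile1.
lra.
Qed.

Lemma linear_geometric_le (r r' a K : R) : 0 < r -> r < r' -> r' <= 1 ->
  0 <= a -> 0 <= K ->
  exists C2, forall k : nat, (1 <= k)%N ->
    Num.sqrt r ^+ k * (a + K * k%:R) <= C2 * r' `^ ((k%:R - 1) / 2).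
Proof.
move=> r0 rr' r'1 a0 K0; have r'0 : 0 < r' by exact: lt_trans rr'.
pose t := Num.sqrt r'; pose q := Num.sqrt r / t.
have t0 : 0 < t by rewrite sqrtr_gt0.
have t1 : t <= 1 by rewrite -sqrtr1 ler_wsqrtr.
have q0 : 0 <= q by rewrite divr_ge0 ?sqrtr_ge0.
have q1 : q < 1 by rewrite ltr_pdivrMr // mul1r ltr_sqrt.
(* The spare factor [q ^+ k] absorbs the linear growth, as [k * q ^+ k <= (1 - q)^-1]. The exponent
   [(k - 1) / 2] leaves one extra factor [t <= 1] to discard. *)
exists (a + K / (1 - q)) => -[//|k] _.
have -> : r' `^ ((k.+1%:R - 1) / 2) = t ^+ k.
  by rewrite -natr1 addrK mulrC powRrM powR12_sqrt ?(ltW r'0) // powR_mulrn // ltW.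
have -> : Num.sqrt r = t * q by rewrite /q mulrC divfK // gt_eqF.
have qk : 0 <= q ^+ k.+1 by rewrite exprn_ge0.
have kq : k.+1%:R * q ^+ k.+1 <= (1 - q)^-1.
  rewrite -[leRHS]mul1r ler_pdivlMr ?subr_gt0 //.
  apply: le_trans (mul_nat_geometric_le _ _) _; first by rewrite q0 ltW.
  by rewrite gerBl.
have aq : q ^+ k.+1 * a <= a by rewrite ler_piMl // exprn_ile1 // ltW.
have Kq := ler_wpM2l K0 kq.
have tk : 0 <= t ^+ k by rewrite exprn_ge0 // ltW.
have B : q ^+ k.+1 * (a + K * k.+1%:R) <= a + K / (1 - q) by lra.
rewrite exprMn -mulrA mulrC [leRHS]mulrC.
rewrite mulrC; apply: le_trans (_ : t ^+ k * (q ^+ k.+1 * (a + K * k.+1%:R)) <= _).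
  apply: ler_wpM2r; first by rewrite mulr_ge0 ?addr_ge0 ?mulr_ge0.
  by rewrite exprS ler_piMl.
exact: ler_wpM2l.
Qed.

End Recursion.

(** * Sampling and constants *)

Section Extrema.
Context {R : realType}.

Lemma inf_range_le {n : nat} (s : 'I_n -> R) i : inf (range s) <= s i.
Proof.
apply: ge_inf; last by exists i.
apply/has_lb_ubN/finite_set_has_ubound; do 2 apply: finite_image.
exact: finite_finset.
Qed.

Lemma inf_range_gt0 {n : nat} (s : 'I_n -> R) :
  (0 < n)%N -> (forall i, 0 < s i) -> 0 < inf (range s).
Proof.
case: n s => // n s _ s0.
have [e e0 es] := seq_positive_lower_bound [seq s i | i : 'I_n.+1].
apply: lt_le_trans e0 _; apply: lb_le_inf => [|_ [i _ <-]].
  by exists (s ord0); exists ord0.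
by apply: es => //; exact: codom_f.
Qed.

Lemma le_sup_range {n : nat} (s : 'I_n -> R) i : s i <= sup (range s).
Proof.
apply: ub_le_sup; last by exists i.
by apply/finite_set_has_ubound/finite_image; exact: finite_finset.
Qed.

Lemma compact_continuous_bounded {p : nat} (A : set 'rV[R]_p)
    (f : 'rV[R]_p -> R) : A !=set0 -> compact A -> continuous f ->
  exists M, forall y, A y -> `|f y| <= M.
Proof.
move=> A0 cA cf; have cfA : {within A, continuous f}.
  exact: continuous_subspaceT.
have [y1 _ H1] := EVT_max_rV A0 cA cfA; have [y2 _ H2] := EVT_min_rV A0 cA cfA.
exists (`|f y1| + `|f y2|) => y /mem_set Ay; rewrite ler_norml.
have := H1 y Ay; have := H2 y Ay; have := ler_norm (f y1).
have := ler_norm (- f y2); rewrite normrN; have := normr_ge0 (f y1); have := normr_ge0 (f y2).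
by move=> ? ? ? ? ? ?; apply/andP; split; lra.
Qed.

End Extrema.

Section Sampling.
Context {R : realType} {p n : nat}.
Variables (f : 'I_n -> 'rV[R]_p -> R).

(** Grouping the batch by function turns the deviation into centered frequencies times values. The
    bound involves [y] only through [M], so a common [M] serves at the next iterate too, although
    that one depends on the batch; it is quadratic in the frequencies, so variances give its
    mean. *)
Lemma batch_objective_deviation (b : nat) (s : nat -> 'I_n) (M : 'I_n -> R)
    (t : R) y : 0 < t -> (forall i, `|f i y| <= M i) ->
  `|batch_objective f b s y - objective f y| <=
  \sum_(i < n) M i / 2 *
    (t * (b%:R^-1 * (\sum_(l < b) (s l == i)%:R) - n%:R^-1) ^+ 2 + t^-1).
Proof.
move=> t0 fM.
have -> : batch_objective f b s y - objective f y = \sum_(i < n)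
    (b%:R^-1 * (\sum_(l < b) (s l == i)%:R) - n%:R^-1) * f i y.
  rewrite /batch_objective /objective.
  under [RHS]eq_bigr do rewrite mulrBl -mulrA mulr_suml.
  rewrite sumrB -!mulr_sumr exchange_big /=; congr (_ * _ - _).
  apply: eq_bigr => l _; rewrite (bigD1 (s l)) //= eqxx mul1r big1 ?addr0 // => i.
  by rewrite eq_sym => /negbTE ->; rewrite mul0r.
apply: le_trans (ler_norm_sum _ _ _) _; apply: ler_sum => i _.
set Z := _ - n%:R^-1; rewrite normrM.
(* AM-GM: [|Z| <= (t Z^2 + 1 / t) / 2] *)
have ZE : `|Z| <= (t * Z ^+ 2 + t^-1) / 2.
  have := mulr_ge0 (ltW t0) (sqr_ge0 (`|Z| - t^-1)).
  have -> : t * (`|Z| - t^-1) ^+ 2 = t * `|Z| ^+ 2 - 2 * `|Z| + t^-1.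
    by field; rewrite gt_eqF.
  by rewrite real_normK ?num_real //; lra.
have -> : M i / 2 * (t * Z ^+ 2 + t^-1) = (t * Z ^+ 2 + t^-1) / 2 * M i by ring.
by apply: ler_pM.
Qed.

End Sampling.

Section Draws.
Context {R : realType} {p n : nat} (P V : set 'rV[R]_p).
Context (f : 'I_n -> 'rV[R]_p -> R) (L : 'I_n -> R) (caratheodory : bool).
Context (b : nat -> nat) {disp : measure_display} {T : measurableType disp}.
Context (Pr : probability T R) (xi : nat -> nat -> T -> 'I_n).
Context (x : nat -> T -> 'rV[R]_p) (mu : nat -> T -> 'rV[R]_p -> R).
Context (Fil : nat -> set (set T)).
Hypothesis run : asfw_run P V f L caratheodory b Pr xi x mu Fil.

Let measurable_draw k l (B : set 'I_n) : (1 <= k)%N -> (l < b k)%N ->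
  measurable (xi k l @^-1` B).
Proof.
by move=> k1 lb; apply: filtration_measurable run _ _ (draws_adapted run B k1 lb).
Qed.

Let draws_pair k (i : 'I_n) (l l' : 'I_(b k)) : (1 <= k)%N -> l != l' ->
  Pr ((xi k l @^-1` [set i]) `&` (xi k l' @^-1` [set i])) =
  (n%:R^-1 * n%:R^-1)%:E.
Proof.
move=> k1 ll'.
(* Only the draws [l] and [l'] are constrained, and the past event is the whole space: mutual
   independence yields the pairwise one. *)
pose B (j : 'I_(b k)) : set 'I_n := if (j == l) || (j == l') then [set i] else setT.
have FT : Fil k setT.
  have [F0 FC _] := filtration_sigma_algebra run k.
  by rewrite -[setT]setD0; exact: FC.
have := draws_independent run B k1 FT.
rewrite setTI probability_setT mul1e.
have -> : [set w | forall j : 'I_(b k), B j (xi k j w)] =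
    (xi k l @^-1` [set i]) `&` (xi k l' @^-1` [set i]).
  apply/seteqP; split=> w /=.
    by move=> Bw; have := Bw l; have := Bw l'; rewrite /B !eqxx orbT.
  move=> [wl wl'] j; rewrite /B; case: eqVneq => [->//|_].
  by case: eqVneq => [->//|].
move=> ->; rewrite (bigD1 l) //= (bigD1 l') //=; last by rewrite eq_sym.
rewrite big1 => [|j /andP[jl jl']].
  by rewrite /B !eqxx orbT !(draws_uniform run) // mule1 EFinM.
by rewrite /B (negbTE jl) (negbTE jl') preimage_setT probability_setT.
Qed.

Lemma draws_variance k (i : 'I_n) : (1 <= k)%N -> (0 < b k)%N ->
  exists2 v : R, v <= (b k)%:R^-1 &
    has_mean Pr (fun w => ((b k)%:R^-1 *
      (\sum_(l < b k) (xi k l w == i)%:R) - n%:R^-1) ^+ 2) v.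
Proof.
move=> k1 bk.
have := has_mean_frequency_variance (Pr := Pr) (c := n%:R^-1)
  (A := fun l : 'I_(b k) => xi k l @^-1` [set i]) bk.
move=> /(_ (fun l => measurable_draw _ k1 (ltn_ord l))).
move=> /(_ (fun l => draws_uniform run _ k1 (ltn_ord l))).
move=> /(_ (fun l l' => draws_pair i k1)) H.
exists ((n%:R^-1 - n%:R^-1 ^+ 2) / (b k)%:R).
  rewrite ler_piMl ?invr_ge0 //.
  have := sqr_ge0 (n%:R^-1 : R); have := ler0n R n => n0.
  have : (n%:R^-1 : R) <= 1.
    case: (n) => [|n']; first by rewrite invr0.
    by rewrite invf_le1 ?ler1n ?ltr0n.
  by lra.
congr (has_mean _ _ _): H; apply/funext => w; congr ((_ * _ - _) ^+ 2).
apply: eq_bigr => l _; rewrite indicE; congr (_%:R); congr nat_of_bool.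
by apply/idP/eqP => [/set_mem|E]; [|apply/mem_set].
Qed.

(** For [t ^+ 2] at most the batch size, the variance term is at most [t^-1], which balances the
    other term. *)
Lemma deviation_mean k (M : 'I_n -> R) (t : R) : (1 <= k)%N ->
  0 < t -> t ^+ 2 <= (b k)%:R -> (forall i, 0 <= M i) ->
  exists2 e : R, e <= (\sum_(i < n) M i) / t &
    has_mean Pr (fun w => \sum_(i < n) M i / 2 *
    (t * ((b k)%:R^-1 * (\sum_(l < b k) (xi k l w == i)%:R) - n%:R^-1) ^+ 2
     + t^-1)) e.
Proof.
move=> k1 t0 tb M0; have bR : (0 : R) < (b k)%:R.
  by apply: lt_le_trans tb; rewrite exprn_gt0.
have bk : (0 < b k)%N by rewrite -(ltr0n R).
have /choice[v vP] : forall i, exists v : R, v <= (b k)%:R^-1 /\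
    has_mean Pr (fun w => ((b k)%:R^-1 *
      (\sum_(l < b k) (xi k l w == i)%:R) - n%:R^-1) ^+ 2) v.
  by move=> i; have [v vb hv] := draws_variance i k1 bk; exists v.
exists (\sum_(i < n) M i / 2 * (t * v i + t^-1)); last first.
  apply: has_mean_sum => i; apply: has_meanZ; apply: has_meanD.
    by apply: has_meanZ; case: (vP i).
  exact: has_mean_cst.
rewrite mulr_suml; apply: ler_sum => i _; rewrite -mulrA.
apply: ler_wpM2l => //.
have : t * v i <= t^-1.
  rewrite -(ler_pM2l t0) mulfV ?gt_eqF // mulrA -expr2.
  have [vb _] := vP i; apply: le_trans (ler_wpM2l (sqr_ge0 t) vb) _.
  by rewrite ler_pdivrMr // mul1r.
lra.
Qed.

End Draws.

(** * The contraction factor and the batch sizes *)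

Section Constants.
Context {R : realType} {m p n : nat}.
Variables (C : 'M[R]_(m, p)) (d : 'cV[R]_m) (sigma L : 'I_n -> R).
Variable caratheodory : bool.
Local Notation P := (polyhedron C d).
Local Notation N := (nb_vertices C d caratheodory).
Local Notation r := (rho C d sigma L caratheodory).

Lemma nb_vertices_gt0 v : vertices C d v -> (0 < N)%N.
Proof.
rewrite /nb_vertices; case: caratheodory => // Vv.
rewrite cardfs_gt0; apply/fset0Pn; exists v.
by rewrite in_fset_set; [exact/mem_set|exact: finite_vertices].
Qed.

Hypothesis W0 : 0 < Omega C d.
Hypothesis D0 : 0 < diameter C d.
Hypothesis N0 : (0 < N)%N.
Hypothesis s0 : 0 < sigmaF sigma.
Hypothesis L0 : 0 < LF L.

Let den0 : 0 < 16 * N%:R ^+ 2 * LF L * diameter C d ^+ 2.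
Proof. by rewrite !mulr_gt0 ?exprn_gt0 ?ltr0n. Qed.

Lemma rho_gt0 : 0 < r.
Proof. by rewrite lt_min divr_gt0 //= divr_gt0 // mulr_gt0 ?exprn_gt0. Qed.

Lemma rho_le : r <= 1 / 2. Proof. by rewrite ge_min lexx. Qed.

Lemma rho_condition (Lb : R) : Lb <= LF L ->
  16 * r * Lb * diameter C d ^+ 2 <= (Omega C d / N%:R) ^+ 2 * sigmaF sigma.
Proof.
move=> LbL; have : r <= Omega C d ^+ 2 * sigmaF sigma /
    (16 * N%:R ^+ 2 * LF L * diameter C d ^+ 2) by rewrite ge_min lexx orbT.
rewrite ler_pdivlMr // => H.
have NR0 : (0 : R) < N%:R ^+ 2 by rewrite exprn_gt0 ?ltr0n.
rewrite expr_div_n [leRHS]mulrAC ler_pdivlMr //.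
apply: le_trans H; have -> : r * (16 * N%:R ^+ 2 * LF L * diameter C d ^+ 2) =
  16 * r * diameter C d ^+ 2 * N%:R ^+ 2 * LF L by ring.
have -> : 16 * r * Lb * diameter C d ^+ 2 * N%:R ^+ 2 =
  16 * r * diameter C d ^+ 2 * N%:R ^+ 2 * Lb by ring.
by rewrite ler_pM2l // !mulr_gt0 ?rho_gt0 ?exprn_gt0 ?ltr0n.
Qed.

(** The exponent [2 * k + 2] is twice [k.+1], so [(1 - r)^-1 ^+ k.+1] is an admissible [t] in
    [deviation_mean]. *)
Lemma batch_size_ge k :
  ((1 - r)^-1 ^+ k.+1) ^+ 2 <= (batch_size C d sigma L caratheodory k)%:R.
Proof.
have r1 : 0 < 1 - r by have := rho_le; lra.
rewrite /batch_size natr_absz; set y := 1 / _.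
have y0 : 0 < y by rewrite divr_gt0 ?exprn_gt0.
rewrite gtr0_norm ?ceil_gt0 //; apply: le_trans (ceil_ge y).
by rewrite -exprM /y div1r exprVn -mulnC mulnS addnC.
Qed.

End Constants.

(** * Convergence *)

Section Run.
Context {R : realType} {m p n : nat}.
Variables (C : 'M[R]_(m, p)) (d : 'cV[R]_m).
Variables (f : 'I_n -> 'rV[R]_p -> R) (sigma L : 'I_n -> R) (caratheodory : bool).
Context {disp : measure_display} {T : measurableType disp}.
Context (Pr : probability T R) (xi : nat -> nat -> T -> 'I_n).
Context (x : nat -> T -> 'rV[R]_p) (mu : nat -> T -> 'rV[R]_p -> R).
Context (Fil : nat -> set (set T)).
Local Notation P := (polyhedron C d).
Local Notation V := (vertices C d).
Local Notation vs := (enum_fset (fset_set V)).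
Local Notation N := (nb_vertices C d caratheodory).
Local Notation r := (rho C d sigma L caratheodory).
Local Notation b := (batch_size C d sigma L caratheodory).

Hypothesis n0 : (0 < n)%N.
Hypothesis cP : compact P.
Hypothesis P2 : exists y z, [/\ P y, P z & y <> z].
Hypothesis fsigma : forall i, 0 < sigma i /\ strongly_convex (sigma i) (f i).
Hypothesis fL : forall i, lipschitz_gradient (L i) (f i).
Hypothesis run : asfw_run P V f L caratheodory b Pr xi x mu Fil.

Let Pn0 : P !=set0. Proof. by have [y [_ [Py _ _]]] := P2; exists y. Qed.

Let df i y : differentiable (f i) y. Proof. by have [] := fL i. Qed.

Let sF0 : 0 < sigmaF sigma.
Proof. by apply: inf_range_gt0 => // i; case: (fsigma i). Qed.

Let f_lower i : quadratic_lower (sigmaF sigma) (f i).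
Proof.
have [_ sc] := fsigma i; have [_ lo] := lipschitz_gradient_bounds (fL i).
move=> y z; apply: le_trans (strongly_convex_quadratic_lower sc lo y z).
rewrite lerD2l ler_wpM2r ?sqr_ge0 // ler_pM2r ?invr_gt0 //.
exact: inf_range_le.
Qed.

Let f_upper i : quadratic_upper (L i) (f i).
Proof. by have [] := lipschitz_gradient_bounds (fL i). Qed.

(** Between two distinct points the lower and upper quadratic bounds compare, which gives
    [sigmaF sigma <= L i]. *)
Let L_gt0 i : 0 < L i.
Proof.
have [y [z [Py Pz yz]]] := P2.
have := le_trans (f_lower i y z) (f_upper i y z); rewrite lerD2l.
have r0 : 0 < enorm (z - y) ^+ 2.
  by rewrite exprn_gt0 // enorm_gt0 subr_eq0 eq_sym; exact/eqP.
by rewrite ler_pM2r // ler_pM2r ?invr_gt0 //; exact: lt_le_trans.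
Qed.

Let LF0 : 0 < LF L.
Proof. exact: lt_le_trans (L_gt0 (Ordinal n0)) (le_sup_range _ _). Qed.

Let batch_lipschitz_bounds k s : (0 < k)%N -> 0 < batch_lipschitz L k s <= LF L.
Proof.
move=> k0; have kR : (0 : R) < k%:R by rewrite ltr0n.
rewrite /batch_lipschitz; apply/andP; split.
  rewrite mulr_gt0 ?invr_gt0 //; case: k k0 {kR} => // k _.
  rewrite big_ord_recl ltr_wpDr ?L_gt0 //.
  by apply: sumr_ge0 => i _; exact: ltW.
rewrite mulrC ler_pdivrMr // mulr_natr -[k in leRHS]card_ord -sumr_const.
by apply: ler_sum => i _; exact: le_sup_range.
Qed.

Let vs_start : exists2 x1, V x1 & forall w, x 1%N w = x1 /\
    forall v, V v -> mu 1%N w v = (v == x1)%:R.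
Proof. exact: asfw_start run. Qed.

Let zp0 : 0 < zeta C d /\ 0 < phi C d.
Proof.
have [v Vv _] := vs_start; have [y [z [Py Pz yz]]] := P2.
(* Of two distinct points, at least one differs from the starting vertex. *)
have [yv|yv] := eqVneq y v; last exact: (zeta_phi_gt0 cP Vv Py (elimN eqP yv)).
by apply: (zeta_phi_gt0 cP Vv Pz) => zv; apply: yz; rewrite yv zv.
Qed.

Let W0 : 0 < Omega C d. Proof. by have [? ?] := zp0; rewrite divr_gt0. Qed.

Let D0 : 0 < diameter C d.
Proof. by have [y [z [Py Pz yz]]] := P2; exact: diameter_gt0 Py Pz yz. Qed.

Let N0 : (0 < N)%N.
Proof. by have [v Vv _] := vs_start; exact: nb_vertices_gt0 Vv. Qed.

Lemma asfw_rho_gt0 : 0 < r. Proof. exact: rho_gt0. Qed.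
Let r0 := asfw_rho_gt0.
Let r12 : r <= 1 / 2. Proof. exact: rho_le. Qed.
Let rr : 0 < 1 - r <= 1.
Proof. by apply/andP; split; move: r0 r12; lra. Qed.

Let b0 k : (0 < b k)%N.
Proof.
rewrite -(ltr0n R); apply: lt_le_trans (batch_size_ge C d sigma L caratheodory k).
by case/andP: rr => r1 _; rewrite !exprn_gt0 // invr_gt0.
Qed.

Let run_step w k : (1 <= k)%N ->
  represents vs (mu k w) (x k w) -> (nb_active vs (mu k w) <= N)%N ->
  let h := batch_objective f (b k) (fun i => xi k i w) in
  [/\ represents vs (mu k.+1 w) (x k.+1 w), (nb_active vs (mu k.+1 w) <= N)%N,
      h (x k.+1 w) <= h (x k w),
      (nb_active vs (mu k.+1 w) <= nb_active vs (mu k w) + 1)%N &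
      forall y, P y -> h y < h (x k w) ->
        h (x k.+1 w) - h y <= (1 - r) * (h (x k w) - h y) \/
        (nb_active vs (mu k.+1 w) < nb_active vs (mu k w))%N].
Proof.
move=> k1 mux muN h; have [z0 ph0] := zp0.
have /andP[Lb0 LbL] := batch_lipschitz_bounds (fun i => xi k i w) (b0 k).
apply: (asfw_step_progress cP z0 ph0 Lb0 sF0 _ _ r12 _ mux muN _).
- exact: (average_quadratic_upper (b0 k) (fun i => df (xi k i w))
    (fun i => f_upper (xi k i w))).
- exact: (average_quadratic_lower (b0 k) (fun i => df (xi k i w))
    (fun i => f_lower (xi k i w))).
- exact: rho_condition.
- exact: asfw_iterate run _ _ k1.
Qed.

Let nb_active_start w : nb_active vs (mu 1%N w) = 1%N.
Proof.
have [x1 Vx1 /(_ w)[_ mu1]] := vs_start.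
have x1vs : x1 \in vs by apply/(mem_vertices C d).
rewrite /nb_active (eq_in_count (a2 := pred1 x1)) => [|v /(mem_vertices C d) Vv].
  by rewrite count_uniq_mem ?fset_uniq // x1vs.
by rewrite /= mu1 // ltr0n lt0b.
Qed.

Let run_represents w k : (1 <= k)%N ->
  represents vs (mu k w) (x k w) /\ (nb_active vs (mu k w) <= N)%N.
Proof.
elim: k => // -[_ _|k IHk _]; last first.
  by have [mux muN] := IHk isT; have [] := run_step (k := k.+1) isT mux muN.
split; last by rewrite nb_active_start.
have [x1 Vx1 /(_ w)[-> mu1]] := vs_start.
have x1vs : x1 \in vs by apply/(mem_vertices C d).
have muE v : v \in vs -> mu 1%N w v = (v == x1)%:R.
  by move=> /(mem_vertices C d); exact: mu1.
split=> [v /muE -> //||]; rewrite big_seq.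
  rewrite (eq_bigr _ muE) -big_seq.
  rewrite -[RHS](sum_delta (fset_uniq _) (fun=> 1 : R^o) x1vs).
  by apply: eq_bigr => v _; rewrite /GRing.scale /= mulr1.
rewrite (eq_bigr (fun v => (v == x1)%:R *: v)) => [|v /muE -> //].
by rewrite -big_seq (sum_delta (fset_uniq _) id).
Qed.

Let continuous_objective : continuous (objective f).
Proof.
by move=> y; apply: differentiable_continuous; exact: (differentiable_average df).
Qed.

Let minimizer : exists y, [/\ P y, forall z, P z -> objective f y <= objective f z
  & inf [set objective f z | z in P] = objective f y].
Proof.
have [y Py ymin] := EVT_min_rV Pn0 cP (continuous_subspaceT continuous_objective).
exists y; move/set_mem: Py => Py; split => //.
  by move=> z /mem_set; exact: ymin.
apply/le_anti/andP; split.
  apply: ge_inf; last by exists y.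
  by exists (objective f y) => _ [z /mem_set Pz <-]; exact: ymin.
apply: lb_le_inf; first by exists (objective f y), y.
by move=> _ [z /mem_set Pz <-]; exact: ymin.
Qed.

(** The recursion is solved separately on each sample path, with random errors but deterministic
    weights; only then are means taken, so no conditional expectation is involved. *)
Lemma asfw_expected_suboptimality : exists a K : R, [/\ 0 <= a, 0 <= K &
  forall k, (1 <= k)%N ->
    ('E_Pr[(fun w => objective f (x k.+1 w) -
       inf [set objective f y | y in P])%R]
     <= (Num.sqrt (1 - r) ^+ k * (a + K * k%:R))%:E)%E].
Proof.
have /andP[r1 r1'] := rr; have [ys [Pys ysmin ->]] := minimizer.
have /choice[M fM] : forall i, exists M, forall y, P y -> `|f i y| <= M.
  move=> i; apply: compact_continuous_bounded => // y.
  exact: differentiable_continuous.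
have M0 i : 0 <= M i.
  by have [y Py] := Pn0; exact: le_trans (normr_ge0 _) (fM i y Py).
pose t k : R := (1 - r)^-1 ^+ k.+1.
have t0 k : 0 < t k by rewrite exprn_gt0 // invr_gt0.
pose dev k w := \sum_(i < n) M i / 2 * (t k * ((b k)%:R^-1 *
  (\sum_(l < b k) (xi k l w == i)%:R) - n%:R^-1) ^+ 2 + (t k)^-1).
have dev0 k w : 0 <= dev k w.
  have tk := ltW (t0 k); apply: sumr_ge0 => i _; rewrite mulr_ge0 ?divr_ge0 //.
  by apply: addr_ge0; [apply: mulr_ge0 => //; exact: sqr_ge0|rewrite invr_ge0].
have /choice[e eP] : forall k, exists e : R,
    e <= (\sum_(i < n) M i) / t k.+1 /\ has_mean Pr (dev k.+1) e.
  move=> k; have [|e ? ?] := deviation_mean run (k := k.+1) isT (t0 k.+1) _ M0.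
    exact: batch_size_ge.
  by exists e.
pose a k w := objective f (x k w) - objective f ys.
have a0 k w : (1 <= k)%N -> 0 <= a k w.
  move=> k1; rewrite subr_ge0; apply: ysmin.
  have [mux _] := run_represents w k1.
  exact: (represents_polyhedron (mem_vertices C d) mux).
have [x1 Vx1 start] := vs_start.
have a1E w : a 1%N w = objective f x1 - objective f ys.
  by rewrite /a; have [-> _] := start w.
pose a1 := objective f x1 - objective f ys.
have a10 : 0 <= a1 by rewrite subr_ge0 ysmin //; exact: vertices_polyhedron.
(* Passing between batch function and objective costs [2 * dev] for the difference of values before
   the step and [2 * dev] for the one after it, hence the factor 4. *)
have path k w : a k.+1 w <= Num.sqrt (1 - r) ^+ k *
    (a1 + \sum_(j < k) 4 / (1 - r) ^+ j.+1 * dev j.+1 w).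
  have := @amortized_contraction _ (a ^~ w) (fun k => 4 * dev k w)
    (fun k => nb_active vs (mu k w)) (1 - r) r1 (nb_active_start w) _ r1' _
    (a0 1%N w isT) _ k.
  rewrite a1E big_add1 big_mkord.
  under eq_bigr do rewrite mulrAC.
  apply=> {k} k k1; have [mux muN] := run_represents w k1.
  - exact: nb_active_gt0 mux.
  - by rewrite mulr_ge0.
  have [mux' _ hdesc nbS hprog] := run_step k1 mux muN.
  set h := batch_objective _ _ _ in hdesc hprog.
  have hdev y : P y -> `|h y - objective f y| <= dev k w.
    by move=> Py; apply: batch_objective_deviation => // i; exact: fM.
  have Px := represents_polyhedron (mem_vertices C d) mux.
  have Px' := represents_polyhedron (mem_vertices C d) mux'.
  have := hdev _ Px; have := hdev _ Px'; have := hdev _ Pys.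
  rewrite !ler_norml /a => /andP[A1 A2] /andP[B1 B2] /andP[C1 C2].
  have dk0 := dev0 k w; have ak0 := a0 k w k1; rewrite /a in ak0.
  (* If the batch function is already no larger at the iterate than at [ys], descent alone bounds
     the new suboptimality by [2 * dev], which counts as a contraction. *)
  have [hle|hlt] := leP (h (x k w)) (h ys).
    left; split => //.
    by have := mulr_ge0 (ltW r1) ak0; lra.
  have [prog|drop] := hprog ys Pys hlt; [left|right]; split=> //; last by lra.
  have : (1 - r) * (h (x k w) - h ys) <= (1 - r) *
      (objective f (x k w) - objective f ys + 2 * dev k w).
    by rewrite ler_pM2l //; lra.
  have : (1 - r) * dev k w <= dev k w by rewrite ler_piMl.
  lra.
exists a1, (4 * \sum_(i < n) M i); split=> // [|k k1].
  by rewrite mulr_ge0 // sumr_ge0.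
have mean := has_meanZ (Num.sqrt (1 - r) ^+ k) (has_meanD (has_mean_cst Pr a1)
  (has_mean_sum (index_enum 'I_k) (fun j : 'I_k =>
    has_meanZ (4 / (1 - r) ^+ j.+1) (proj2 (eP j))))).
apply: le_trans (expectation_le_mean _ mean) _.
  by move=> w; rewrite path a0.
rewrite lee_fin ler_wpM2l ?exprn_ge0 ?sqrtr_ge0 // lerD2l.
rewrite mulr_natr -[k in leRHS]card_ord -sumr_const; apply: ler_sum => j _.
(* The mean of [dev j.+1] is at most a multiple of [(1 - r) ^+ j.+2], which cancels the weight
   [(1 - r) ^- j.+1]; each of the [k] terms is thus bounded by the same constant. *)
have [ej _] := eP j; rewrite -mulrA ler_wpM2l //.
rewrite mulrC ler_pdivrMr ?exprn_gt0 //; apply: le_trans ej _.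
apply: ler_wpM2l; first exact: sumr_ge0.
by rewrite /t exprVn invrK ler_wiXn2l // ltW.
Qed.

End Run.

Theorem theorem1 (R : realType) (m p n : nat)
    (C : 'M[R]_(m, p)) (d : 'cV[R]_m)
    (f : 'I_n -> 'rV[R]_p -> R) (sigma L : 'I_n -> R) (caratheodory : bool)
    (disp : measure_display) (T : measurableType disp) (Pr : probability T R)
    (xi : nat -> nat -> T -> 'I_n)
    (x : nat -> T -> 'rV[R]_p) (mu : nat -> T -> 'rV[R]_p -> R)
    (Fil : nat -> set (set T)) :
  (0 < n)%N ->
  compact (polyhedron C d) ->
  (exists y z, [/\ polyhedron C d y, polyhedron C d z & y <> z]) ->
  (forall i, 0 < sigma i /\ strongly_convex (sigma i) (f i)) ->
  (forall i, lipschitz_gradient (L i) (f i)) ->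
  asfw_run (polyhedron C d) (vertices C d) f L caratheodory
    (batch_size C d sigma L caratheodory) Pr xi x mu Fil ->
  let Fstar := inf [set objective f y | y in polyhedron C d] in
  exists C2 beta : R,
    [/\ 0 < beta, beta < rho C d sigma L caratheodory,
        rho C d sigma L caratheodory <= 1 / 2 &
        forall k : nat, (1 <= k)%N ->
          ('E_Pr[(fun w => objective f (x k.+1 w) - Fstar)%R]
           <= (C2 * (1 - beta) `^ ((k%:R - 1) / 2))%:E)%E].
Proof.
move=> n0 cP P2 fsigma fL run Fstar.
have [a [K [a0 K0 bound]]] := asfw_expected_suboptimality n0 cP P2 fsigma fL run.
have r0 := asfw_rho_gt0 n0 cP P2 fsigma fL run.
set r := rho C d sigma L caratheodory in r0 bound *.
have r12 : r <= 1 / 2 by exact: rho_le.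
(* Taking [beta] as half of [r] makes [1 - beta] strictly larger than [1 - r], the room needed to
   absorb the linear factor. *)
have [|||||C2 C2P] := @linear_geometric_le _ (1 - r) (1 - r / 2) a K; [lra..|].
exists C2, (r / 2); split=> [|||k k1]; [lra..|].
 apply: le_trans (bound k k1) _; rewrite lee_fin; exact: C2P.
Qed.
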